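(* For $$X^\delta=\mathcal S^0_p(\mathcal T^\delta),\qquad Y_2^\delta=\mathcal S^{-1}_p(\mathcal F^\delta_{\Gamma_D}),$$ the operator $\Pi_2^\delta:=(P_2^\delta)'$, the adjoint of the Scott–Zhang type projector $P_2^\delta$ described in the context, satisfies $\Pi_2^\delta\in\mathcal L(\widetilde H^{-\frac12}(\Gamma_D),Y_2^\delta)$, with norm bounded uniformly in all $\mathcal T^\delta$ that satisfy a uniform shape regularity condition, and $$\int_{\Gamma_D}w\,(\mathrm{Id}-\Pi_2^\delta)v\,ds=0\qquad(w\in X^\delta,\ v\in\widetilde H^{-\frac12}(\Gamma_D)).$$
   Context: $\Omega\subset\mathbb R^d$, $d\ge2$, is a bounded Lipschitz polytope; $\Gamma_D,\Gamma_N\subset\partial\Omega$ are closed with $\Gamma_D\cup\Gamma_N=\partial\Omega$ and $|\Gamma_D\cap\Gamma_N|=0$. $\mathcal T^\delta$ is a conforming, shape regular partition of $\Omega$ into closed $d$-simplices such that $\Gamma_D$ is a union of facets of simplices in $\mathcal T^\delta$; $\mathcal F^\delta_{\Gamma_D}$ is the set of those (closed) facets that are contained in $\Gamma_D$. $p\ge1$ is a fixed integer. $\mathcal S^0_p(\mathcal T^\delta)$ is the space of continuous functions on $\Omega$ whose restriction to each $K\in\mathcal T^\delta$ is a polynomial of degree at most $p$; $\mathcal S^{-1}_p(\mathcal F^\delta_{\Gamma_D})$ is the space of (possibly discontinuous) functions on $\Gamma_D$ whose restriction to each $e\in\mathcal F^\delta_{\Gamma_D}$ is a polynomial of degree at most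 $p$, and $\mathcal S^0_p(\mathcal F^\delta_{\Gamma_D})$ is its subspace of continuous functions. $\widetilde H^{-\frac12}(\Gamma_D):=H^{\frac12}(\Gamma_D)'$, in which $L_2(\Gamma_D)$ is embedded via the $L_2(\Gamma_D)$-scalar product; $\int_{\Gamma_D}w\,v\,ds$ denotes the corresponding duality pairing of the trace of $w$ on $\Gamma_D$ with $v$. The operator $P_2^\delta$: let $\{\phi_i^\delta\}$ be the nodal basis of $\mathcal S^0_p(\mathcal F^\delta_{\Gamma_D})$ (a space that contains the traces on $\Gamma_D$ of functions in $X^\delta$). It is known that there exists a Scott–Zhang type projector of the form $$P_2^\delta v=\sum_i\langle v,\psi_i^\delta\rangle_{L_2(\Gamma_D)}\,\phi_i^\delta,$$ where $\{\psi_i^\delta\}\subset Y_2^\delta$ is biorthogonal to $\{\phi_i^\delta\}$, such that $P_2^\delta$ is bounded in $L_2(\Gamma_D)$ and in $H^1(\Gamma_D)$, and such that, for $f_2\in H^{p+1}(\Gamma_D)$, $$\|(\mathrm{Id}-P_2^\delta)f_2\|_{H^{\frac12}(\Gamma_D)}\lesssim\Big(\sum_{e\in\mathcal F^\delta_{\Gamma_D}}(h_\delta|_e)^{2p+1}|f_2|^2_{H^{p+1}(e)}\Big)^{1/2},$$ where $h_\delta|_e=|K|^{1/d}$ for the simplex $K\in\mathcal T^\delta$ having $e$ as a facet. $P_2^\delta$ is fixed to be such a projector, so $\Pi_2^\delta v=\sum_i\langle v,\phi_i^\delta\rangle\,\psi_i^\delta$ with $\langle\cdot,\cdot\rangle$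 the duality pairing. *)

(* Defs.v *)
From HB Require Import structures.
From mathcomp Require Import all_boot all_order all_algebra.
From mathcomp Require Import all_classical all_reals all_analysis.
Set Implicit Arguments.
Unset Strict Implicit.
Unset Printing Implicit Defensive.
Import Order.TTheory GRing.Theory Num.Theory.
Import numFieldNormedType.Exports.
Local Open Scope classical_set_scope.
Local Open Scope ring_scope.

(* The library norm of 'rV[R]_d is the maximum norm; it induces the right
   topology, but lengths, normals and surface measure need the Euclidean one. *)
Section Euclidean.
Variables (R : realType) (d : nat).
Implicit Types x y : 'rV[R]_d.

Definition dotv x y : R := \sum_i x 0 i * y 0 i.
Definition enorm x : R := Num.sqrt (dotv x x).
Definition eucl_dist x y : R := enorm (x - y).

End Euclidean.

(* Volume of the Euclidean unit ball of R^n: 1, 2, pi, 4 pi / 3, ... *)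
Fixpoint unit_ball_volume (R : realType) (n : nat) : R :=
  match n with
  | 0 => 1
  | 1 => 2
  | m.+2 => 2 * pi / m.+2%:R * unit_ball_volume R m
  end.

Lemma unit_ball_volume_ge0 (R : realType) n : 0 <= unit_ball_volume R n.
Proof.
suff: (0 <= unit_ball_volume R n) && (0 <= unit_ball_volume R n.+1).
  by case/andP.
elim: n => [|n /andP[h0 h1]]; first by rewrite ler01 ler0n.
rewrite h1 andTb; apply: mulr_ge0 => //.
by rewrite divr_ge0 ?ler0n// mulr_ge0 ?ler0n// pi_ge0.
Qed.

Section Hausdorff.
Variables (R : realType) (d s : nat).
Local Notation V := 'rV[R]_d.
Local Open Scope ereal_scope.

(* omega_s (diam E / 2)^s if diam E <= delta, and +oo otherwise; the adjoined
   0 gives the empty set weight 0. *)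
Definition hausdorff_gauge (delta : R) (E : set V) : \bar R :=
  if `[< forall x y, E x -> E y -> (eucl_dist x y <= delta)%R >] then
    ereal_sup (0 |` [set (unit_ball_volume R s * (eucl_dist x y / 2) ^+ s)%:E
                      | x in E & y in E])
  else +oo.

(* Countable covers by arbitrary sets: mu_ext is used on the discrete
   sigma-algebra of V. *)
Definition hausdorff_content (delta : R) : set V -> \bar R :=
  @mu_ext _ (g_sigma_algebraType [set: set V]) R (hausdorff_gauge delta).

Definition hausdorff (A : set V) : \bar R :=
  ereal_sup [set hausdorff_content delta A | delta in [set e : R | (0 < e)%R]].

Lemma hausdorff_gauge0 delta : hausdorff_gauge delta set0 = 0.
Proof.
rewrite /hausdorff_gauge asboolT; last by move=> x y [].
rewrite (_ : [set _ | _ in _ & _ in _] = set0) ?setU0 ?ereal_sup1//.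
by apply/seteqP; split => // x [y []].
Qed.

Lemma hausdorff_gauge_ge0 delta A : 0 <= hausdorff_gauge delta A.
Proof.
rewrite /hausdorff_gauge; case: ifPn => // _.
by apply: ereal_sup_ubound; left.
Qed.

Lemma hausdorff0 : hausdorff set0 = 0.
Proof.
rewrite /hausdorff (_ : [set _ | _ in _] = [set 0]) ?ereal_sup1//.
apply/seteqP; split => [_ [e _ <-]|_ ->] /=.
  apply: mu_ext0; [exact: hausdorff_gauge0|exact: hausdorff_gauge_ge0].
exists 1%R; rewrite /= ?ltr01//.
apply: mu_ext0; [exact: hausdorff_gauge0|exact: hausdorff_gauge_ge0].
Qed.

Lemma hausdorff_ge0 A : 0 <= hausdorff A.
Proof.
apply: (@le_trans _ _ (hausdorff_content 1 A)).
  by apply: mu_ext_ge0; exact: hausdorff_gauge_ge0.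
by apply: ereal_sup_ubound; exists 1%R; rewrite /= ?ltr01.
Qed.

Lemma le_hausdorff : {homo hausdorff : A B / A `<=` B >-> A <= B}.
Proof.
move=> A B AB; apply: ge_ereal_sup => _ [e e0 <-].
apply: (@le_trans _ _ (hausdorff_content e B)); first exact: le_mu_ext.
by apply: ereal_sup_ubound; exists e.
Qed.

Lemma hausdorff_sigma_subadditive : sigma_subadditive hausdorff.
Proof.
move=> F; apply: ge_ereal_sup => _ [e e0 <-].
apply: le_trans.
  by apply: mu_ext_sigma_subadditive; exact: hausdorff_gauge_ge0.
apply: lee_nneseries => [i _ _|i _].
  by apply: mu_ext_ge0; exact: hausdorff_gauge_ge0.
by apply: ereal_sup_ubound; exists e.
Qed.

HB.instance Definition _ := isOuterMeasure.Build R V hausdorff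
  hausdorff0 hausdorff_ge0 le_hausdorff hausdorff_sigma_subadditive.

End Hausdorff.

Definition hausdorff_outer (R : realType) (d : nat) :
    {outer_measure set 'rV[R]_d -> \bar R} :=
  @hausdorff R d d.-1.

(* R^d with the sigma-algebra of Caratheodory-measurable sets of H^(d-1), which
   contains the Borel sets. *)
Notation surface_space R d := (caratheodory_type (hausdorff_outer R d)).

Definition surface_measure (R : realType) (d : nat) :
    {measure set (surface_space R d) -> \bar R} :=
  (hausdorff_outer R d : set (surface_space R d) -> \bar R).

Definition surface_integral (R : realType) (d : nat) (D : set 'rV[R]_d)
    (f : 'rV[R]_d -> R) : \bar R :=
  (\int[surface_measure R d]_(x in (D : set (surface_space R d))) (f x)%:E)%E.

Section Domain.
Variables (R : realType) (d : nat).
Local Notation V := 'rV[R]_d.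
Implicit Types (Omega : set V) (K : 'M[R]_(d.+1, d)).

Definition boundary Omega : set V := closure Omega `\` interior Omega.

(* Near each boundary point, and in suitable orthonormal coordinates whose last
   axis is n, Omega is the set below the graph of a Lipschitz function zeta;
   zeta is evaluated on the hyperplane orthogonal to n only. *)
Definition lipschitz_boundary Omega := forall x, boundary Omega x ->
  exists (n : V) (zeta : V -> R) (L r : R),
    [/\ enorm n = 1, 0 < r,
        forall y y', `|zeta y - zeta y'| <= L * eucl_dist y y' &
        forall y, eucl_dist x y < r ->
          (Omega y <-> dotv y n < zeta (y - dotv y n *: n))].

(* The rows of K are the d + 1 vertices of a simplex; face K S is the convex
   hull of the vertices with index in S. *)
Definition face K (S : {set 'I_d.+1}) : set V :=
  [set x | exists l : 'rV[R]_d.+1,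
    [/\ forall i, 0 <= l 0 i, forall i, i \notin S -> l 0 i = 0,
        \sum_i l 0 i = 1 & x = l *m K]].
Definition simplex K : set V := face K [set: 'I_d.+1]%SET.
Definition facet (e : 'M[R]_(d.+1, d) * 'I_d.+1) : set V :=
  face e.1 (~: [set e.2])%SET.

Definition simplex_volume K : R :=
  `|\det (\matrix_(i < d) (row (lift ord0 i) K - row ord0 K))| / d`!%:R.

Definition lipschitz_polytope Omega :=
  [/\ open Omega, bounded_set Omega, lipschitz_boundary Omega &
      exists s : seq 'M[R]_(d.+1, d),
        (forall K, K \in s -> 0 < simplex_volume K) /\
        closure Omega = \bigcup_(K in [set` s]) simplex K].

Definition conforming_triangulation Omega (T : seq 'M[R]_(d.+1, d)) :=
  [/\ uniq T, forall K, K \in T -> 0 < simplex_volume K,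
      closure Omega = \bigcup_(K in [set` T]) simplex K &
      forall K L, K \in T -> L \in T -> K != L ->
        exists S S' : {set 'I_d.+1},
          [/\ S != [set: 'I_d.+1]%SET, simplex K `&` simplex L = face K S &
              face K S = face L S']].

(* diam K <= kappa * (radius of a ball inscribed in K). *)
Definition shape_regular (kappa : R) (T : seq 'M[R]_(d.+1, d)) :=
  forall K, K \in T -> exists (c : V) (r : R),
    [/\ 0 < r, forall y, eucl_dist c y <= r -> simplex K y &
        forall x y, simplex K x -> simplex K y -> eucl_dist x y <= kappa * r].

(* A pair (K, i) stands for the facet of K opposite to the vertex i.  A facet
   contained in the boundary belongs to one K only, so no facet is repeated. *)
Definition facets_in (Gamma : set V) (T : seq 'M[R]_(d.+1, d)) :
    seq ('M[R]_(d.+1, d) * 'I_d.+1) :=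
  [seq e <- [seq (K, i) | K <- T, i <- enum 'I_d.+1]
     | `[< facet e `<=` Gamma >]].

Definition admissible Omega (GammaD : set V) (T : seq 'M[R]_(d.+1, d)) :=
  conforming_triangulation Omega T /\
  GammaD = \bigcup_(e in [set` facets_in GammaD T]) facet e.

Definition mesh_width (e : 'M[R]_(d.+1, d) * 'I_d.+1) : R :=
  simplex_volume e.1 `^ (d%:R^-1).

(* Omega coincides with the half-space {y | (y - x) . n < 0} near x. *)
Definition outer_unit_normal Omega (x n : V) :=
  enorm n = 1 /\ exists2 r : R, 0 < r &
    forall y, eucl_dist x y < r -> (Omega y <-> dotv (y - x) n < 0).

(* Surface-almost everywhere on the boundary of a polytope the set is a
   singleton; on the remaining ridges the value is 0. *)
Definition normal Omega (x : V) : V := xget 0 (outer_unit_normal Omega x).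

Definition tangent Omega (x : V) (i : 'I_d) : V :=
  delta_mx 0 i - normal Omega x 0 i *: normal Omega x.

Definition iter_derive (f : V -> R^o) (vs : seq V) : V -> R^o :=
  foldr (fun v (g : V -> R^o) => 'D_v g) f vs.

Definition smooth (f : V -> R^o) := forall vs x, differentiable (iter_derive f vs) x.

Definition tangential_derive Omega (f : V -> R^o) (s : seq 'I_d) (x : V) : R :=
  iter_derive f (map (tangent Omega x) s) x.

End Domain.

Section FunctionSpaces.
Variables (R : realType) (d : nat) (Omega GammaD : set 'rV[R]_d).
Local Notation V := 'rV[R]_d.
Local Notation ds := (surface_measure R d).
Implicit Types (v w : V -> R).

(* Elements of function spaces on GammaD are represented by total functions on
   R^d of which only the values on GammaD matter. *)

Definition L2norm v : \bar R :=
  (surface_integral GammaD (fun x => (v x ^+ 2)%R) `^ 2^-1)%E.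

Definition L2 v :=
  measurable_fun (GammaD : set (surface_space R d))
    (v : surface_space R d -> R) /\ (L2norm v < +oo)%E.

Definition L2dot v w : R := fine (surface_integral GammaD (fun x => v x * w x)).

(* v is in H^k(GammaD), the closure of the smooth functions on R^d restricted to
   GammaD, and (G s) are its weak tangential derivatives; the (G s) with s of
   size j are the components of the j-th tangential derivative tensor in the
   standard basis of R^d. *)
Definition sobolev_derivs (k : nat) v (G : seq 'I_d -> V -> R) :=
  [/\ G [::] = v, forall s, (size s <= k)%N -> L2 (G s) &
      exists f : nat -> V -> R^o, (forall n, smooth (f n)) /\
        forall s, (size s <= k)%N ->
          L2norm (fun x => tangential_derive Omega (f n) s x - G s x)
            @[n --> \oo] --> 0%E].

(* The G with sobolev_derivs 1 v G are unique almost everywhere; the infimum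
   merely turns the norm into a function of v, equal to +oo outside H^1. *)
Definition H1norm v : \bar R :=
  ereal_inf [set ((L2norm v `^ 2 + \sum_(i < d) L2norm (G [:: i]) `^ 2)
                   `^ 2^-1)%E
              | G in [set G | sobolev_derivs 1 v G]].

Definition H1 v := exists G, sobolev_derivs 1 v G.

(* H^(1/2)(GammaD) = [L_2(GammaD), H^1(GammaD)]_(1/2, 2), with the norm given
   by Peetre's K-functional. *)
Definition Kfunctional (t : R) v : \bar R :=
  ereal_inf [set (L2norm (v \- v1)%R + t%:E * H1norm v1)%E | v1 in H1].

Definition Hhalf_norm v : \bar R :=
  ((\int[lebesgue_measure]_(t in [set t : R | (0 < t)%R])
      (((t `^ (- 2^-1))%:E * Kfunctional t v) `^ 2 * (t^-1)%:E)) `^ 2^-1)%E.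

Definition Hhalf v := L2 v /\ (Hhalf_norm v < +oo)%E.

(* Dual of Hhalf.  Boundedness makes a functional independent of the choice of
   representatives. *)
Definition dual_norm (v : (V -> R) -> R) : \bar R :=
  ereal_sup [set (`|v w|)%:E
              | w in [set w | Hhalf w /\ (Hhalf_norm w <= 1)%E]].

Definition Hmhalf (v : (V -> R) -> R) :=
  (forall a w1 w2, Hhalf w1 -> Hhalf w2 ->
     v (fun x => a * w1 x + w2 x) = a * v w1 + v w2) /\
  (dual_norm v < +oo)%E.

Variable p : nat.
Variable T : seq 'M[R]_(d.+1, d).

Definition poly_degree_le (q : V -> R) :=
  exists c : {ffun 'I_d -> 'I_p.+1} -> R,
    forall x, q x = \sum_(m : {ffun 'I_d -> 'I_p.+1} | (\sum_i m i <= p)%N)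
                      c m * \prod_i x 0 i ^+ m i.

(* S^0_p(T): as Omega is covered by the closed simplices, a continuous piecewise
   polynomial on Omega extends continuously to closure Omega. *)
Definition Xdelta w :=
  {within closure Omega, continuous w} /\
  forall K, K \in T ->
    exists2 q, poly_degree_le q & forall x, simplex K x -> w x = q x.

(* S^(-1)_p(F_GammaD): a function on GammaD up to null sets, since neighbouring
   facets overlap in ridges. *)
Definition Ydelta v :=
  forall e, e \in facets_in GammaD T ->
    exists2 q, poly_degree_le q & {ae ds, forall x, facet e x -> v x = q x}.

Definition S0facets v :=
  {within GammaD, continuous v} /\
  forall e, e \in facets_in GammaD T ->
    exists2 q, poly_degree_le q & forall x, facet e x -> v x = q x.

(* Points whose barycentric coordinates in a facet are multiples of 1/p. *)
Definition lagrange_node (z : V) :=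
  exists2 e, e \in facets_in GammaD T &
    exists a : 'I_d.+1 -> nat,
      [/\ a e.2 = 0%N, (\sum_i a i)%N = p &
          z = \sum_i ((a i)%:R / p%:R) *: row i e.1].

Definition nodal_basis (n : nat) (phi : 'I_n -> V -> R) :=
  exists z : 'I_n -> V,
    [/\ injective z,
        forall y, lagrange_node y <-> exists i, y = z i,
        forall i, S0facets (phi i),
        forall i j, phi i (z j) = (i == j)%:R &
        forall w, S0facets w ->
          forall x, GammaD x -> w x = \sum_i w (z i) * phi i x].

End FunctionSpaces.

Record projector_data (R : realType) (d : nat) := ProjectorData {
  pd_size : nat;
  pd_phi : 'I_pd_size -> 'rV[R]_d -> R;
  pd_psi : 'I_pd_size -> 'rV[R]_d -> R }.

Section Projector.
Variables (R : realType) (d : nat) (Omega GammaD : set 'rV[R]_d).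
Variables (p : nat) (D : projector_data R d).
Local Notation V := 'rV[R]_d.
Local Notation ds := (surface_measure R d).

Definition P2 (v : V -> R) : V -> R :=
  fun x => \sum_i L2dot GammaD v (pd_psi (p := D) i) * pd_phi (p := D) i x.

Definition Pi2 (v : (V -> R) -> R) : (V -> R) -> R := fun w => v (P2 w).

(* The density on GammaD that represents Pi2 v. *)
Definition Pi2fun (v : (V -> R) -> R) : V -> R :=
  fun x => \sum_i v (pd_phi (p := D) i) * pd_psi (p := D) i x.

Definition scott_zhang_form (T : seq 'M[R]_(d.+1, d)) :=
  [/\ nodal_basis GammaD p T (pd_phi (p := D)),
      forall i, Ydelta GammaD p T (pd_psi (p := D) i) &
      forall i j, L2dot GammaD (pd_phi (p := D) j) (pd_psi (p := D) i)
                  = (i == j)%:R].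

Definition P2_L2_bounded (C : R) := forall v, L2 GammaD v ->
  (L2norm GammaD (P2 v) <= C%:E * L2norm GammaD v)%E.

Definition P2_H1_bounded (C : R) := forall v, H1 Omega GammaD v ->
  H1 Omega GammaD (P2 v) /\
  (H1norm Omega GammaD (P2 v) <= C%:E * H1norm Omega GammaD v)%E.

(* |f|^2_(H^(p+1)(e)) is the inner sum over the derivatives of order p + 1. *)
Definition P2_approximates (T : seq 'M[R]_(d.+1, d)) (C : R) :=
  forall f G, sobolev_derivs Omega GammaD p.+1 f G ->
  (Hhalf_norm Omega GammaD (f \- P2 f)%R <=
   C%:E * (\sum_(e <- facets_in GammaD T)
             (mesh_width e ^+ (2 * p + 1))%:E *
             \sum_(s : p.+1.-tuple 'I_d)
               surface_integral (facet e) (fun x => (G s x ^+ 2)%R)) `^ 2^-1)%E.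

End Projector.

(* Main.v *)
Require Import Defs.
From mathcomp Require Import all_boot all_order all_algebra.
From mathcomp Require Import all_classical all_reals all_analysis.
From mathcomp Require Import measurable_realfun.
From mathcomp Require Import ring lra.
Set Implicit Arguments.
Unset Strict Implicit.
Unset Printing Implicit Defensive.
Import Order.TTheory GRing.Theory Num.Theory.
Import numFieldNormedType.Exports.
Local Open Scope classical_set_scope.
Local Open Scope ring_scope.

(** Algebraically the proposition is duality: [P2] pairs with the [psi i] and
    expands in the [phi i], so its adjoint pairs with the [phi i] and expands in
    the [psi i].  The density that represents [Pi2 v] is piecewise polynomial
    because the [psi i] are ([Ydelta_sum]).

    To evaluate a functional [v] on [H^(1/2)] at [P2 w], however, the nodal
    functions [phi i] have to lie in [H^(1/2)(GammaD)], a space defined through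
    closures of smooth functions, in which they are not visibly contained.  The
    projector itself supplies this.  By the theorem of Stone and Weierstrass
    there are polynomials [g i] that are uniformly close to the [phi i] on
    [GammaD], so that the matrix of the products of the [g i] and the [psi j] is
    close to the identity and invertible; hence every combination of the [phi i]
    is exactly [P2 f] for a polynomial [f] ([P2_polynomial_surjective]).  Since
    [f] is in [H^1] and [P2] preserves [H^1], so is the combination
    ([H1_nodal]), and [H^1] is contained in [H^(1/2)] ([H1_Hhalf]).

    The norm bound is interpolation: a multiple of [P2] is a contraction of
    [L_2] and of [H^1], so it decreases every value of the K-functional
    ([Hhalf_norm_contraction], [Pi2_dual_norm_le]).  For the orthogonality, the
    trace of a finite element function [w] is a combination of the [phi i],
    which [P2] reproduces by biorthogonality ([P2_S0facets]); so [w - P2 w]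
    vanishes on [GammaD], all its multiples have norm zero, and a bounded
    functional vanishes on it ([Hmhalf_vanishing]).

    All of this rests on a few facts about the surface measure.  Closed sets are
    measurable, by the criterion of Caratheodory for metric outer measures
    ([metric_caratheodory_closed], [hausdorff_metric]); facets have finite
    measure ([facet_hausdorff_lty]); and the normal of the domain is measurable,
    because it is locally constant where it exists ([measurable_normal]).
    Therefore continuous functions and their tangential derivatives are in [L_2]
    of the compact set [GammaD], and the measure being complete, so are functions
    that agree almost everywhere with a polynomial on each facet. *)

(** * Metric outer measures *)

Section MetricOuterMeasure.
Variables (R : realType) (V : normedModType R).
Variable mu : {outer_measure set V -> \bar R}.
Hypothesis mu_metric : forall (A B : set V) (eta : R), 0 < eta ->
  (forall a b, A a -> B b -> eta <= `|a - b|) ->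
  (mu A + mu B <= mu (A `|` B))%E.

(** The criterion of Caratheodory.  Let [E n] be the part of [X] at distance at
    least [1 / (n + 1)] from [C].  It is separated from [C], so it remains to see
    that [mu (E n)] tends to [mu (X `\` C)].  The shells [S n] between [E n] and
    [E (n + 1)] are separated when they are not neighbours, whence their measures
    sum up to at most [2 * mu X], and the tails of that series tend to zero. *)
Lemma metric_caratheodory_closed (C : set V) : closed C -> mu.-caratheodory C.
Proof.
move=> clC; apply: le_caratheodory_measurable => X.
have [->|Xfin] := eqVneq (mu X) +oo%E; first exact: leey.
pose E n := [set x | X x /\ forall y, C y -> n.+1%:R^-1 <= `|x - y| :> R].
have EX n : E n `<=` X by move=> x [].
have EC n : E n `<=` ~` C.
  move=> x [_ h] Cx; have := h x Cx; rewrite subrr normr0 leNgt invr_gt0.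
  by rewrite ltr0n.
have invS n m : (n <= m)%N -> m.+1%:R^-1 <= n.+1%:R^-1 :> R.
  by move=> nm; rewrite lef_pV2 ?posrE ?ltr0n// ler_nat.
have EE n m : (n <= m)%N -> E n `<=` E m.
  move=> nm x [Xx h]; split=> // y /h; apply: le_trans; exact: invS.
pose S n := E n.+1 `\` E n.
have muE n : (mu (X `&` C) + mu (E n) <= mu X)%E.
  apply: le_trans (le_outer_measure mu _ _ _).
    apply: (@mu_metric _ _ n.+1%:R^-1); first by rewrite invr_gt0 ltr0n.
    by move=> a b [_ Ca] [_ /(_ _ Ca)]; rewrite distrC.
  by move=> x [[]//|/EX].
have muEX n : (mu (E n) <= mu X)%E by apply: le_outer_measure.
(* Points of [S n.+1] are closer than [1 / (n + 2)] to [C], and those of [E n]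
   are not closer than [1 / (n + 1)]. *)
have sepS n : (mu (E n) + mu (S n.+1) <= mu (E n.+2))%E.
  apply: le_trans (le_outer_measure mu _ _ _).
    apply: (@mu_metric _ _ (n.+1%:R^-1 - n.+2%:R^-1)).
      by rewrite subr_gt0 ltf_pV2 ?posrE ?ltr0n// ltr_nat.
    move=> a b [Xa Ea] [[Xb Eb] nEb].
    have [y [Cy yb]] : exists y, C y /\ `|b - y| < n.+2%:R^-1.
      apply: contrapT => /forallNP ny; apply: nEb; split=> // y Cy.
      by rewrite leNgt; apply/negP => h; apply: (ny y).
    move: yb (Ea y Cy) (ler_distD b a y).
    move: (n.+1%:R^-1) (n.+2%:R^-1) => u v; lra.
  move=> x [|[]]; last by [].
  by apply: EE; rewrite ltnW.
have sumS n : (\sum_(0 <= k < n) mu (S k) <= mu (E n) + mu (E n.-1))%E.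
  elim: n => [|[|n] ih].
  - by rewrite big_geq// adde_ge0 ?outer_measure_ge0.
  - rewrite big_nat1; apply: le_trans (leeDl _ (outer_measure_ge0 mu _)).
    by apply: le_outer_measure => x [].
  - rewrite big_nat_recr//=.
    apply: (le_trans (leeD ih (lexx _))).
    by rewrite -addeA addeC; apply: leeD => //=; exact: sepS.
have Sfin : (\sum_(0 <= k <oo) mu (S k) < +oo)%E.
  apply: (@le_lt_trans _ _ (mu X + mu X)%E).
    apply: lime_le; first by apply: is_cvg_nneseries => *; apply: outer_measure_ge0.
    by apply: nearW => n; apply: (le_trans (sumS n)); apply: leeD.
  by rewrite lte_add_pinfty// ltey.
have tail0 : (fun n => \sum_(n <= k <oo) mu (S k))%E @ \oo --> 0%E.
  by apply: nneseries_tail_cvg => // k _; exact: outer_measure_ge0.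
(* As [C] is closed, each point of [X] outside [C] has positive distance to it. *)
have decomp n : X `&` ~` C `<=` E n `|` \bigcup_(k in ~` `I_n) S k.
  move=> x [Xx nCx].
  have [m Em] : exists m, E m x.
    have : nbhs x (~` C) by apply: open_nbhs_nbhs; split=> //; exact: closed_openC.
    rewrite -nbhs_ballE => -[e /= e0 eC].
    have [m _ /= me] : exists2 m, True & m.+1%:R^-1 < e.
      by have [m] := ltr_add_invr e0; rewrite add0r => me; exists m.
    exists m; split => // y Cy; rewrite leNgt; apply/negP => xy.
    by apply: (eC y) => //; rewrite -ball_normE /=; exact: lt_trans me.
  have [En|nEn] := pselect (E n x); [by left|right].
  have ex : exists m, `[< E m x >] by exists m; apply/asboolP.
  case: (ex_minnP ex) => k /asboolP Ek kmin.
  have nk : (n < k)%N.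
    by rewrite ltnNge; apply/negP => kn; apply: nEn; exact: EE Ek.
  case: k nk Ek kmin => // k nk Ek kmin.
  exists k; first by rewrite /= ltnS in nk *; apply/negP; rewrite -leqNgt.
  split=> // /asboolP /kmin; by rewrite ltnn.
have bound n : (mu (X `&` C) + mu (X `&` ~` C) <=
    mu X + \sum_(n <= k <oo) mu (S k))%E.
  apply: (@le_trans _ _ (mu (X `&` C) + (mu (E n) + \sum_(n <= k <oo) mu (S k)))%E).
    apply: leeD => //; apply: (le_trans (le_outer_measure mu _ _ (decomp n))).
    apply: (le_trans (outer_measureU2 mu _ _)); apply: leeD => //.
    exact: outer_measure_sigma_subadditive_tail.
  by rewrite addeA; apply: leeD.
have lim : (fun n => mu X + \sum_(n <= k <oo) mu (S k))%E @ \oo --> (mu X + 0)%E.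
  apply: cvgeD => //; last exact: cvg_cst.
  by rewrite fin_num_adde_defl.
rewrite -[leRHS]adde0 -(cvg_lim _ lim)//; apply: lime_ge.
  by apply/cvg_ex; eexists; exact: lim.
by apply: nearW.
Qed.

End MetricOuterMeasure.

(** * The Hausdorff measure is metric *)

Section Hausdorff_metric.
Variables (R : realType) (d : nat).
Local Notation V := 'rV[R]_d.
Implicit Types (x y : V) (A B : set V).

Lemma dotv_ge0 x : 0 <= dotv x x.
Proof. by apply: sumr_ge0 => i _; rewrite -expr2 sqr_ge0. Qed.

Lemma le_coord_enorm x i : `|x 0 i| <= enorm x.
Proof.
rewrite -sqrtr_sqr; apply: ler_wsqrtr.
rewrite /dotv (bigD1 i)//= expr2 lerDl.
by apply: sumr_ge0 => j _; rewrite -expr2 sqr_ge0.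
Qed.

Lemma le_norm_enorm x : `|x| <= enorm x.
Proof.
rewrite /Num.norm/= mx_normrE; apply: bigmax_le; first exact: sqrtr_ge0.
by move=> [i j] _ /=; rewrite ord1 le_coord_enorm.
Qed.

Lemma le_coord_norm x i : `|x 0 i| <= `|x|.
Proof.
rewrite [leRHS]/Num.norm/= mx_normrE.
by apply: (le_bigmax _ (fun ij : 'I_1 * 'I_d => `|x ij.1 ij.2|) (0, i)).
Qed.

Lemma enorm_le_norm x : enorm x <= d%:R * `|x|.
Proof.
rewrite -[leRHS]ger0_norm ?mulr_ge0 ?ler0n// -sqrtr_sqr; apply: ler_wsqrtr.
apply: (@le_trans _ _ (d%:R * `|x| ^+ 2)).
  rewrite (_ : d%:R * _ = \sum_(i < d) `|x| ^+ 2); last first.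
    by rewrite sumr_const card_ord mulr_natl.
  apply: ler_sum => i _.
  rewrite -expr2 -[leLHS]ger0_norm ?sqr_ge0// normrX.
  by rewrite ler_pXn2r ?nnegrE// le_coord_norm.
rewrite exprMn; apply: ler_wpM2r; first exact: sqr_ge0.
rewrite -natrX ler_nat; by case: (d) => // n; rewrite expnS leq_pmulr.
Qed.

Lemma hausdorff_gauge_far s (delta : R) A x y : A x -> A y ->
  delta < eucl_dist x y -> hausdorff_gauge s delta A = +oo%E.
Proof.
move=> Ax Ay xy; rewrite /hausdorff_gauge asboolF// => /(_ x y Ax Ay).
by rewrite leNgt xy.
Qed.

Lemma measurable_discrete A :
  @measurable _ (g_sigma_algebraType [set: set V]) A.
Proof. exact: sub_sigma_algebra. Qed.

Lemma hausdorff_content_anti s (e1 e2 : R) A : e1 <= e2 ->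
  (hausdorff_content s e2 A <= hausdorff_content s e1 A)%E.
Proof.
move=> e12; apply: le_ereal_inf_tmp => _ [F cF <-].
apply: (@le_trans _ _ (\sum_(k <oo) hausdorff_gauge s e2 (F k))%E).
  by apply: ereal_inf_lbound; exists F.
apply: lee_nneseries => k _; first by move=> _; exact: hausdorff_gauge_ge0.
rewrite /hausdorff_gauge; case: asboolP => [h2|h2].
  by case: asboolP => // h1; rewrite leey.
rewrite asboolF// => h1; apply: h2 => x y Fx Fy; exact: le_trans (h1 _ _ Fx Fy) e12.
Qed.

(** A set of diameter at most [delta] meets only one of [A] and [B], so that a
    cover of the union splits into a cover of [A] and one of [B]. *)
Lemma hausdorff_content_separated s (delta : R) A B :
  (forall a b, A a -> B b -> delta < `|a - b|) ->
  (hausdorff_content s delta A + hausdorff_content s delta B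
   <= hausdorff_content s delta (A `|` B))%E.
Proof.
move=> sep; apply: le_ereal_inf_tmp => _ [F [mF cF] <-].
pose meeting (D : set V) k := if `[< D `&` F k !=set0 >] then F k else set0.
have cov (D : set V) : D `<=` A `|` B ->
    (hausdorff_content s delta D <=
     \sum_(k <oo) hausdorff_gauge s delta (meeting D k))%E.
  move=> DAB; apply: ereal_inf_lbound; exists (meeting D) => //; split.
    by move=> k; exact: measurable_discrete.
  move=> x Dx; have [k _ Fx] := cF x (DAB x Dx); exists k => //.
  by rewrite /meeting asboolT//; exists x.
apply: (le_trans (leeD (cov A (@subsetUl _ _ _)) (cov B (@subsetUr _ _ _)))).
rewrite -nneseriesD; [|by move=> *; exact: hausdorff_gauge_ge0..].
apply: lee_nneseries => k _.
  by move=> _; rewrite adde_ge0 ?hausdorff_gauge_ge0.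
rewrite /meeting; case: asboolP => [[a [Aa Fa]]|_]; last first.
  rewrite hausdorff_gauge0 add0e; case: asboolP => // _.
  by rewrite hausdorff_gauge0 hausdorff_gauge_ge0.
case: asboolP => [[b [Bb Fb]]|_]; last by rewrite hausdorff_gauge0 adde0.
rewrite (hausdorff_gauge_far s Fa Fb) ?leey//.
exact: lt_le_trans (sep _ _ Aa Bb) (le_norm_enorm _).
Qed.

(** Separation in the maximum norm is enough, as it is the smaller one. *)
Lemma hausdorff_metric s A B (eta : R) : 0 < eta ->
  (forall a b, A a -> B b -> eta <= `|a - b|) ->
  (hausdorff s A + hausdorff s B <= hausdorff s (A `|` B))%E.
Proof.
move=> eta0 sep.
have [->|Hfin] := eqVneq (hausdorff s (A `|` B)) +oo%E; first exact: leey.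
have key e1 e2 : 0 < e1 -> 0 < e2 ->
    (hausdorff_content s e1 A + hausdorff_content s e2 B
     <= hausdorff s (A `|` B))%E.
  move=> e10 e20; pose e := Num.min (eta / 2) (Num.min e1 e2).
  have e0 : 0 < e by rewrite !lt_min e10 e20 divr_gt0.
  have ee : e < eta.
    by apply: (@le_lt_trans _ _ (eta / 2)); [rewrite ge_min lexx|lra].
  apply: (@le_trans _ _ (hausdorff_content s e A + hausdorff_content s e B)%E).
    by apply: leeD; apply: hausdorff_content_anti; rewrite !ge_min lexx ?orbT.
  apply: (@le_trans _ _ (hausdorff_content s e (A `|` B))).
    apply: hausdorff_content_separated => a b Aa Bb.
    exact: lt_le_trans ee (sep _ _ Aa Bb).
  by apply: ereal_sup_ubound; exists e.
have content_ge0 (e : R) D : (0 <= hausdorff_content s e (D : set V))%E.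
  by apply: mu_ext_ge0; exact: hausdorff_gauge_ge0.
have fin e D : 0 < e -> D `<=` A `|` B -> hausdorff_content s e D \is a fin_num.
  move=> e0 DAB; rewrite ge0_fin_numE ?content_ge0//.
  apply: (@le_lt_trans _ _ (hausdorff s (A `|` B))); last by rewrite ltey.
  apply: (le_trans _ (le_hausdorff s DAB)).
  by apply: ereal_sup_ubound; exists e.
have finA : hausdorff s A \is a fin_num.
  rewrite ge0_fin_numE ?hausdorff_ge0//.
  apply: (@le_lt_trans _ _ (hausdorff s (A `|` B))); last by rewrite ltey.
  by apply: le_hausdorff; left.
rewrite -leeBrDl//; apply: ge_ereal_sup => _ [e2 e20 <-].
rewrite leeBrDl// -leeBrDr; last by apply: fin => //; right.
apply: ge_ereal_sup => _ [e1 e10 <-].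
rewrite leeBrDr; first exact: key.
by apply: fin => //; right.
Qed.

Lemma closed_surface_measurable A : closed A ->
  measurable (A : set (surface_space R d)).
Proof.
move=> clA.
apply: (@metric_caratheodory_closed R 'rV[R]_d (hausdorff_outer R d)) => //.
by move=> B C eta eta0; exact: hausdorff_metric eta0.
Qed.

End Hausdorff_metric.

(** * Finite measure of facets *)

Section FacetMeasure.
Variables (R : realType) (d : nat).
Local Notation V := 'rV[R]_d.

Lemma hausdorff_gauge_le s (delta e : R) (E : set V) :
  0 <= e -> e <= delta -> (forall x y, E x -> E y -> eucl_dist x y <= e) ->
  (hausdorff_gauge s delta E <= (unit_ball_volume R s * (e / 2) ^+ s)%:E)%E.
Proof.
move=> e0 ed Ee; rewrite /hausdorff_gauge asboolT; last first.
  by move=> x y Ex Ey; exact: le_trans (Ee _ _ Ex Ey) ed.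
apply: ge_ereal_sup => _ [->|[x Ex [y Ey <-]]].
  by rewrite lee_fin mulr_ge0 ?unit_ball_volume_ge0// exprn_ge0// divr_ge0.
rewrite lee_fin ler_wpM2l ?unit_ball_volume_ge0//.
rewrite lerXn2r ?nnegrE ?divr_ge0 ?sqrtr_ge0//.
by rewrite ler_pM2r ?invr_gt0//; exact: Ee.
Qed.

Lemma hausdorff_content_finite_cover s (delta e : R) (I : finType)
    (E : I -> set V) (A : set V) :
  0 <= e -> e <= delta -> A `<=` \bigcup_i E i ->
  (forall i x y, E i x -> E i y -> eucl_dist x y <= e) ->
  (hausdorff_content s delta A <=
   (#|I|%:R * (unit_ball_volume R s * (e / 2) ^+ s))%:E)%E.
Proof.
move=> e0 ed AE Ee; set c := _ * (e / 2) ^+ s.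
pose F k := if insub k is Some j then E (enum_val (j : 'I_#|I|)) else set0.
apply: (@le_trans _ _ (\sum_(k <oo) hausdorff_gauge s delta (F k))%E).
  apply: ereal_inf_lbound; exists F => //; split.
    by move=> k; exact: measurable_discrete.
  move=> x /AE[i _ Eix]; exists (enum_rank i) => //.
  by rewrite /F valK enum_rankK.
rewrite (nneseries_split _ #|I|); last first.
  by move=> *; exact: hausdorff_gauge_ge0.
rewrite [X in (_ + X)%E]eseries0 ?adde0; last first.
  by move=> k Ik _; rewrite /F insubN -?leqNgt// hausdorff_gauge0.
rewrite big_mkord add0n; apply: (@le_trans _ _ (\sum_(i < #|I|) c%:E)%E).
  apply: lee_sum => i _; rewrite /F valK; apply: hausdorff_gauge_le => //.
  exact: Ee.
by rewrite sumEFin sumr_const card_ord mulr_natl.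
Qed.

(** Cover the unit cube by [(N + 1) ^ s] cells of side [1 / N]; their images have
    diameter at most [L / N], so that the sum of their gauges stays bounded as [N]
    grows. *)
Lemma hausdorff_lipschitz_cube s (g : ('I_s -> R) -> V) (L : R) : 0 <= L ->
  (forall c c' e, (forall j, `|c j - c' j| <= e) ->
     eucl_dist (g c) (g c') <= L * e) ->
  (hausdorff s [set g c | c in [set c | forall j, (0 <= c j <= 1)%R]] <=
   (unit_ball_volume R s * L ^+ s)%:E)%E.
Proof.
move=> L0 gL; apply: ge_ereal_sup => _ [delta /= delta0 <-].
have [N [N0 Nd]] : exists N, (0 < N)%N /\ L / N%:R <= delta.
  have [m] := ltr_add_invr (divr_gt0 delta0 (ltr_wpDl L0 ltr01)).
  rewrite add0r => md; exists m.+1; split=> //.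
  have : m.+1%:R^-1 * (L + 1) < delta by rewrite -ltr_pdivlMr// ltr_wpDl.
  by rewrite mulrDr mulr1 mulrC => /ltW; apply: le_trans; rewrite lerDl.
have N0' : 0 < N%:R :> R by rewrite ltr0n.
pose E (m : {ffun 'I_s -> 'I_N.+1}) := [set g c | c in
  [set c : 'I_s -> R | forall j, (m j)%:R <= N%:R * c j <= (m j)%:R + 1]].
apply: le_trans (hausdorff_content_finite_cover s (e := L / N%:R) _ Nd
  (E := E) _ _) _.
- by rewrite divr_ge0 ?ler0n.
- move=> _ [c c01 <-].
  have mN j : (Num.truncn (N%:R * c j) < N.+1)%N.
    have /andP[c0 c1] := c01 j.
    rewrite ltnS -(ler_nat R); apply: (@le_trans _ _ (N%:R * c j)).
      by have /andP[] := truncn_itv (mulr_ge0 (ltW N0') c0).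
    by rewrite -[leRHS]mulr1 ler_wpM2l// ltW.
  exists [ffun j => Ordinal (mN j)] => //; exists c => // j; rewrite ffunE /=.
  have /andP[c0 c1] := c01 j.
  have /andP[-> /ltW] := truncn_itv (mulr_ge0 (ltW N0') c0).
  by rewrite -natr1.
- move=> m _ _ [c cm <-] [c' cm' <-]; apply: gL => j.
  rewrite -[leRHS]mul1r ler_pdivlMr// -[X in _ * X](ger0_norm (ltW N0')) -normrM.
  have /andP[h1 h2] := cm j; have /andP[h3 h4] := cm' j.
  rewrite mulrBl ![_ * N%:R]mulrC ler_norml; lra.
rewrite lee_fin card_ffun !card_ord natrX mulrCA ler_wpM2l ?unit_ball_volume_ge0//.
rewrite -exprMn lerXn2r ?nnegrE ?mulr_ge0 ?ler0n ?divr_ge0//.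
rewrite mulrA ler_pdivrMr// mulrA ler_pdivrMr//.
have : 1 <= N%:R :> R by rewrite ler1n.
rewrite -natr1; nra.
Qed.

Lemma face_compact (K : 'M[R]_(d.+1, d)) S : compact (face K S).
Proof.
pose B := [set l : 'rV[R]_d.+1 | [/\ forall i, 0 <= l 0 i,
  forall i, i \notin S -> l 0 i = 0 & \sum_i l 0 i = 1]].
have -> : face K S = (fun l : 'rV[R]_d.+1 => l *m K) @` B.
  apply/seteqP; split => [x [l [l0 lS l1 ->]]|_ [l [l0 lS l1] <-]].
    by exists l.
  by exists l.
have ccoord i : continuous (fun l : 'rV[R]_d.+1 => l 0 i).
  exact: coord_continuous.
apply: continuous_compact.
  apply: continuous_subspaceT => l.
  rewrite (_ : (fun l => _) = (fun l : 'rV[R]_d.+1 => \sum_i l 0 i *: row i K)).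
    move: l; apply: continuous_big; first exact: add_continuous.
    by move=> i _ l; exact: (cvgZr_tmp (ccoord i l)).
  by apply/funext => m; rewrite mulmx_sum_row.
apply: bounded_closed_compact.
  exists 1; split=> // M M1 l [l0 lS l1]; apply: le_trans (ltW M1).
  rewrite [leLHS]/Num.norm/= mx_normrE; apply: bigmax_le => // -[i j] _ /=.
  rewrite ord1 ger0_norm// -l1 (bigD1 j)//= lerDl.
  by apply: sumr_ge0.
have -> : B = (\bigcap_i [set l : 'rV[R]_d.+1 | 0 <= l 0 i]) `&`
    (\bigcap_(i in [set i | i \notin S]) [set l : 'rV[R]_d.+1 | l 0 i = 0]) `&`
    [set l : 'rV[R]_d.+1 | \sum_i l 0 i = 1].
  apply/seteqP; split => [l [l0 lS l1]|l [[l0 lS] l1]].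
    by split => //; split => i *; [exact: l0|exact: lS].
  by split => // i; exact: l0.
apply: closedI; first apply: closedI.
- apply: closed_bigI => i _.
  by apply: (preimage_closed (D := [set x : R | 0 <= x]));
    [move=> ? _; exact: ccoord|exact: closed_ge].
- apply: closed_bigI => i _.
  by apply: (preimage_closed (D := [set x : R | x = 0]));
    [move=> ? _; exact: ccoord|exact: closed_eq].
- apply: (preimage_closed (f := fun l : 'rV[R]_d.+1 => \sum_i l 0 i)
    (D := [set x : R | x = 1])).
    move=> l _; move: l; apply: continuous_big; first exact: add_continuous.
    by move=> i _; exact: ccoord.
  exact: closed_eq.
Qed.

End FacetMeasure.

(** Of the [d + 1] barycentric coordinates of a point of the facet, that of the
    opposite vertex vanishes, and the sum one determines another; the remaining
    [d - 1] range in a cube. *)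
Lemma facet_hausdorff_lty (R : realType) (d : nat)
    (e : 'M[R]_(d.+1, d) * 'I_d.+1) : (0 < d)%N ->
  (hausdorff d.-1 (facet e) < +oo)%E.
Proof.
case: e => K i; rewrite /facet /=; case: d K i => // s K i _ /=.
pose a0 := row (lift i ord0) K.
pose a (j : 'I_s) := row (lift i (lift ord0 j)) K - a0.
pose g (c : 'I_s -> R) := a0 + \sum_j c j *: a j.
pose L := s.+1%:R * \sum_j `|a j|.
have L0 : 0 <= L by rewrite mulr_ge0 ?ler0n// sumr_ge0.
have gL (c c' : 'I_s -> R) (e : R) : (forall j, `|c j - c' j| <= e) ->
    eucl_dist (g c) (g c') <= L * e.
  move=> cc; rewrite /eucl_dist; apply: (le_trans (enorm_le_norm _)).
  rewrite /L -mulrA ler_wpM2l ?ler0n// /g opprD addrACA subrr add0r -sumrB.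
  rewrite mulr_suml; apply: (le_trans (ler_norm_sum _ _ _)).
  apply: ler_sum => j _; rewrite -scalerBl normrZ mulrC.
  by rewrite ler_wpM2l.
apply: le_lt_trans (ltry (unit_ball_volume R s * L ^+ s)).
apply: le_trans _ (hausdorff_lipschitz_cube L0 gL).
apply: le_hausdorff => x [l [l0 lS l1 ->]].
have li : l 0 i = 0 by apply: lS; rewrite !inE eqxx.
have l1' : l 0 (lift i ord0) + \sum_(j < s) l 0 (lift i (lift ord0 j)) = 1.
  by rewrite -l1 [RHS](bigD1_ord i)//= li add0r big_ord_recl.
exists (fun j => l 0 (lift i (lift ord0 j))).
  move=> j /=; rewrite l0/= -l1' (bigD1 j)//= addrCA lerDl.
  by rewrite addr_ge0// sumr_ge0.
rewrite /g mulmx_sum_row (bigD1_ord i)//= li scale0r add0r big_ord_recl.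
under eq_bigr do rewrite scalerBr.
rewrite sumrB -scaler_suml -/a0 addrCA addrC.
congr (_ + _); rewrite -[X in X - _]scale1r -scalerBl; congr (_ *: _).
by rewrite -l1' addrK.
Qed.

(** * Measurability of the normal *)

Section Normal.
Variables (R : realType) (d : nat).
Local Notation V := 'rV[R]_d.
Implicit Types (x y n : V) (Omega : set V).

Lemma dotvBl x y n : dotv (x - y) n = dotv x n - dotv y n.
Proof. by rewrite -sumrB; apply: eq_bigr => i _; rewrite !mxE mulrBl. Qed.

Lemma dotvZl (a : R) x n : dotv (a *: x) n = a * dotv x n.
Proof. by rewrite mulr_sumr; apply: eq_bigr => i _; rewrite !mxE mulrA. Qed.

Lemma dotvC x y : dotv x y = dotv y x.
Proof. by apply: eq_bigr => i _; rewrite mulrC. Qed.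

Lemma dotv_continuous n : continuous (fun y : V => dotv y n).
Proof.
apply: continuous_big; first exact: add_continuous.
move=> i _ y; exact: (cvgMr_tmp (@coord_continuous R 1 d 0 i y)).
Qed.

Lemma dotv_enorm n : dotv n n = enorm n ^+ 2.
Proof. by rewrite sqr_sqrtr// dotv_ge0. Qed.

Lemma dotv_eq0 n : dotv n n = 0 -> n = 0.
Proof.
move=> n0; apply/rowP => i; rewrite mxE; apply/eqP; rewrite -normr_le0.
by rewrite (le_trans (le_coord_enorm n i))// /enorm n0 sqrtr0.
Qed.

(** Both half-spaces cut the same set out of a small ball, and by homogeneity
    they coincide; their unit normals then do. *)
Lemma outer_unit_normal_unique Omega x n m :
  outer_unit_normal Omega x n -> outer_unit_normal Omega x m -> n = m.
Proof.
move=> [n1 [r r0 rn]] [m1 [s s0 sm]].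
have nn : dotv n n = 1 by rewrite dotv_enorm n1 expr1n.
have mm : dotv m m = 1 by rewrite dotv_enorm m1 expr1n.
have nm y : dotv y n < 0 <-> dotv y m < 0.
  pose t := Num.min r s / (d%:R * `|y| + 1).
  have c0 : 0 < d%:R * `|y| + 1 by rewrite ltr_wpDl// mulr_ge0.
  have rs0 : 0 < Num.min r s by rewrite lt_min r0.
  have t0 : 0 < t by rewrite divr_gt0.
  have ty : eucl_dist x (x + t *: y) < Num.min r s.
    rewrite /eucl_dist opprD addrA subrr add0r.
    apply: (le_lt_trans (enorm_le_norm _)); rewrite normrN normrZ gtr0_norm//.
    rewrite mulrCA /t -mulrA -[ltRHS]mulr1 ltr_pM2l//.
    by rewrite ltr_pdivrMl// mulr1 ltrDl.
  move: ty; rewrite lt_min => /andP[/rn tr /sm ts].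
  move: tr ts; rewrite [x + _]addrC addrK !dotvZl !pmulr_rlt0// => -> ->.
  by [].
have mn0 : 0 < dotv n m.
  have /nm : dotv (- m) m < 0 by rewrite -scaleN1r dotvZl mm mulr1 ltrN10.
  by rewrite -scaleN1r dotvZl mulN1r oppr_lt0 dotvC.
pose y := n - dotv n m *: m.
have ym : dotv y m = 0 by rewrite dotvBl dotvZl mm mulr1 subrr.
have yn : dotv y n = 0.
  apply/eqP; rewrite eq_le; apply/andP; split; rewrite leNgt; apply/negP.
    move=> h; have /nm : dotv (- y) n < 0 by rewrite -scaleN1r dotvZl mulN1r oppr_lt0.
    by rewrite -scaleN1r dotvZl ym mulr0 ltxx.
  by move/nm; rewrite ym ltxx.
have nm1 : dotv n m = 1.
  move: yn; rewrite dotvBl dotvZl nn [dotv m n]dotvC => /eqP.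
  rewrite subr_eq0 eq_sym -expr2 sqrf_eq1 => /orP[/eqP//|/eqP h].
  by move: mn0; rewrite h ltr0N1.
apply/eqP; rewrite -subr_eq0; apply/eqP; apply: dotv_eq0.
by rewrite dotvBl ![dotv _ (n - m)]dotvC !dotvBl nn mm [dotv m n]dotvC nm1 !subrr.
Qed.

Lemma normalE Omega x n : outer_unit_normal Omega x n -> normal Omega x = n.
Proof.
move=> xn; exact: outer_unit_normal_unique (xgetI 0 xn) xn.
Qed.

Lemma normal_le1 Omega x i : `|normal Omega x 0 i| <= 1.
Proof.
have [[n xn]|/forallNP nx] := pselect (exists n, outer_unit_normal Omega x n).
  by rewrite (normalE xn); case: xn => <- _; exact: le_coord_enorm.
by rewrite /normal xgetPN// mxE normr0.
Qed.

(** A point of the boundary near [x] lies on the tangent hyperplane at [x], since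
    nearby points strictly on either side of it are interior to the domain or to
    its complement; so both points have the same half-space. *)
Lemma outer_unit_normal_locally_constant Omega x n :
  outer_unit_normal Omega x n ->
  \forall x' \near x, boundary Omega x' -> outer_unit_normal Omega x' n.
Proof.
move=> [n1 [r r0 rn]].
pose rho := r / (2 * (d%:R + 1)).
have d0 : 0 < d%:R + 1 :> R by rewrite ltr_wpDl.
have rho0 : 0 < rho by rewrite divr_gt0// mulr_gt0.
have rho_r y : `|x - y| < rho + rho -> eucl_dist x y < r.
  move=> xy; apply: (le_lt_trans (enorm_le_norm _)).
  apply: (@le_lt_trans _ _ ((d%:R + 1) * `|x - y|)); first by rewrite ler_wpM2r// lerDl.
  rewrite -ltr_pdivlMl//; apply: (lt_le_trans xy).
  rewrite /rho invfM; lra.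
apply/nbhs_ballP; exists rho => //= x'; rewrite -ball_normE /= => xx' [clx' intx'].
have near_x y : `|x' - y| < rho -> (Omega y <-> dotv (y - x) n < 0).
  move=> x'y; apply: rn; apply: rho_r.
  by apply: le_lt_trans (ler_distD x' _ _) _; rewrite ltrD.
have cont : (fun y => dotv (y - x) n) @ x' --> dotv (x' - x) n.
  rewrite dotvBl; under eq_fun do rewrite dotvBl.
  exact: (cvgB (@dotv_continuous n x') (cvg_cst _)).
have x'0 : dotv (x' - x) n = 0.
  apply/eqP; rewrite eq_le; apply/andP; split; rewrite leNgt; apply/negP => h.
    have : closure Omega x' by [].
    move=> /(_ [set y | `|x' - y| < rho /\ 0 < dotv (y - x) n]) [].
      apply: filterI.
        by apply/nbhs_ballP; exists rho => // y; rewrite -ball_normE.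
      exact: (cvgr_gt _ cont).
    by move=> y [] /= Oy [] /near_x/iffLR /(_ Oy) /ltW; rewrite leNgt => /negP.
  apply: intx'; apply: filterS
    (_ : nbhs x' [set y | `|x' - y| < rho /\ dotv (y - x) n < 0]).
    by move=> y [] /near_x ->.
  apply: filterI.
    by apply/nbhs_ballP; exists rho => // y; rewrite -ball_normE.
  exact: (cvgr_lt _ cont).
split=> //; exists rho => // y x'y.
have -> : dotv (y - x') n = dotv (y - x) n.
  by move: x'0; rewrite !dotvBl; lra.
apply: near_x; exact: le_lt_trans (le_norm_enorm _) x'y.
Qed.

(** The normal is locally constant on a relatively open part of the boundary and
    zero on the rest, so that its restriction to [G] has as preimage of any set
    the union of a relatively open and a closed subset of [G]. *)
Lemma measurable_normal Omega (G : set V) (i : 'I_d) :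
  closed G -> G `<=` boundary Omega ->
  measurable_fun (G : set (surface_space R d))
    ((fun x => normal Omega x 0 i) : surface_space R d -> R).
Proof.
move=> clG GO _ B _.
have mG : measurable (G : set (surface_space R d)) by exact: closed_surface_measurable.
pose has_normal x := exists n, outer_unit_normal Omega x n.
pose U (C : set R) := interior [set x : V | boundary Omega x ->
  has_normal x /\ C (normal Omega x 0 i)].
have mU C : measurable (G `\` U C : set (surface_space R d)).
  apply: closed_surface_measurable; rewrite setDE; apply: closedI => //.
  apply: open_closedC; exact: open_interior.
have mU' C : measurable (G `&` U C : set (surface_space R d)).
  rewrite (_ : G `&` U C = G `\` (G `\` U C)); first exact: measurableD.
  by rewrite setDD.
have UE C x : G x -> U C x <-> has_normal x /\ C (normal Omega x 0 i).
  move=> Gx; split=> [/nbhs_singleton|[[n xn] Cx]].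
    by apply; exact: GO.
  move: (outer_unit_normal_locally_constant xn); apply: filterS => y yn /yn {}yn.
  by split; [exists n|rewrite (normalE yn) -(normalE xn)].
rewrite (_ : G `&` _ = (G `&` U B) `|`
    (if `[< B 0 >] then G `\` U setT else set0)); last first.
  apply/seteqP; split=> [x [Gx Bx]|x [[Gx /(UE _ _ Gx)[_ Bx]]//|]].
    have [hx|hx] := pselect (has_normal x); first by left; split=> //; apply/(UE _ _ Gx).
    right; rewrite asboolT.
      by split => // /(UE _ _ Gx)[].
    by move: Bx; rewrite /= /normal xgetPN ?mxE// => n xn; apply: hx; exists n.
  case: asboolP => // B0 [Gx Ux]; split=> //=.
  rewrite /normal xgetPN ?mxE// => n xn; apply: Ux; apply/(UE _ _ Gx).
  by split => //; exists n.
by apply: measurableU => //; case: ifP.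
Qed.

End Normal.

(** * Polynomials are smooth *)

Section PolynomialFunctions.
Variables (R : realType) (d : nat).
Local Notation V := 'rV[R]_d.
Implicit Types (f g : V -> R^o).

(** In contrast to [poly_degree_le], the degree is left open, which makes this
    class closed under products and directional derivatives. *)
Inductive polynomial_function : (V -> R^o) -> Prop :=
| polynomial_cst c : polynomial_function (fun=> c)
| polynomial_coord i : polynomial_function (fun x => x 0 i)
| polynomialD f g : polynomial_function f -> polynomial_function g ->
    polynomial_function (fun x => f x + g x)
| polynomialM f g : polynomial_function f -> polynomial_function g ->
    polynomial_function (fun x => f x * g x).

Lemma polynomial_sum (I : Type) (s : seq I) (P : pred I) (F : I -> V -> R^o) :
  (forall i, P i -> polynomial_function (F i)) ->
  polynomial_function (fun x => \sum_(i <- s | P i) F i x).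
Proof.
move=> pF; elim: s => [|i s ih].
  under eq_fun do rewrite big_nil.
  exact: polynomial_cst.
under eq_fun do rewrite big_cons.
by case: (P i) (pF i) => [/(_ isT) pFi|//]; exact: polynomialD.
Qed.

Lemma polynomialX f m : polynomial_function f ->
  polynomial_function (fun x => f x ^+ m).
Proof.
move=> pf; elim: m => [|m ih].
  under eq_fun do rewrite expr0.
  exact: polynomial_cst.
under eq_fun do rewrite exprS.
exact: polynomialM.
Qed.

Lemma polynomial_prod (I : Type) (s : seq I) (F : I -> V -> R^o) :
  (forall i, polynomial_function (F i)) ->
  polynomial_function (fun x => \prod_(i <- s) F i x).
Proof.
move=> pF; elim: s => [|i s ih].
  under eq_fun do rewrite big_nil.
  exact: polynomial_cst.
under eq_fun do rewrite big_cons.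
exact: polynomialM.
Qed.

Lemma poly_degree_le_polynomial p (q : V -> R) :
  poly_degree_le p q -> polynomial_function q.
Proof.
move=> [c qE]; rewrite (_ : q = fun x => \sum_(m : {ffun 'I_d -> 'I_p.+1} |
  (\sum_i m i <= p)%N) c m * \prod_i x 0 i ^+ m i); last exact/funext.
apply: polynomial_sum => m _; apply: polynomialM; first exact: polynomial_cst.
apply: polynomial_prod => i; apply: polynomialX; exact: polynomial_coord.
Qed.

Lemma polynomial_differentiable f x : polynomial_function f -> differentiable f x.
Proof.
elim=> [c|i|{}f g _ ihf _ ihg|{}f g _ ihf _ ihg].
- exact: differentiable_cst.
- exact: differentiable_coord.
- exact: differentiableD.
- exact: differentiableM.
Qed.

Lemma polynomial_continuous f : polynomial_function f -> continuous f.
Proof.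
by move=> pf x; exact/differentiable_continuous/polynomial_differentiable.
Qed.

Lemma derive_coord (v x : V) i : 'D_v (fun y : V => y 0 i : R^o) x = v 0 i.
Proof.
rewrite /derive; apply: cvg_lim => //; apply: cvg_near_cst; near=> h.
have h0 : h != 0 by near: h; exact: nbhs_dnbhs_neq.
by rewrite /= !mxE addrK scalerA mulVf// scale1r.
Unshelve. all: by end_near. Qed.

Lemma polynomial_derive f v : polynomial_function f ->
  polynomial_function ('D_v f).
Proof.
elim=> [c|i|{}f g pf ihf pg ihg|{}f g pf ihf pg ihg].
- rewrite (_ : 'D_v _ = fun=> 0); first exact: polynomial_cst.
  by apply/funext => x; exact: derive_cst.
- rewrite (_ : 'D_v _ = fun=> v 0 i); first exact: polynomial_cst.
  by apply/funext => x; exact: derive_coord.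
- rewrite (_ : 'D_v _ = fun x => 'D_v f x + 'D_v g x); first exact: polynomialD.
  apply/funext => x; rewrite deriveD//; exact/diff_derivable/polynomial_differentiable.
- rewrite (_ : 'D_v _ = fun x => f x * 'D_v g x + g x * 'D_v f x).
    by apply: polynomialD; exact: polynomialM.
  apply/funext => x; rewrite deriveM//; exact/diff_derivable/polynomial_differentiable.
Qed.

Lemma polynomial_smooth f : polynomial_function f -> smooth f.
Proof.
move=> pf vs x; apply: polynomial_differentiable.
by elim: vs => //= v vs ih; exact: polynomial_derive.
Qed.

Lemma derive_sum_coord f (v x : V) : differentiable f x ->
  'D_v f x = \sum_k v 0 k * 'D_(delta_mx 0 k) f x.
Proof.
move=> df; rewrite deriveE// {1}(row_sum_delta v) linear_sum.
by apply: eq_bigr => k _; rewrite linearZ/= deriveE.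
Qed.

Lemma tangential_derive1 Omega f (x : V) i : differentiable f x ->
  tangential_derive Omega f [:: i] x =
  'D_(delta_mx 0 i) f x -
  normal Omega x 0 i * \sum_k normal Omega x 0 k * 'D_(delta_mx 0 k) f x.
Proof.
move=> df; rewrite /tangential_derive /= /tangent deriveE// linearB/= linearZ/=.
by rewrite -!deriveE//; congr (_ - _ * _); exact: derive_sum_coord.
Qed.

Lemma iter_deriveZ (a : R) f vs : smooth f ->
  iter_derive (fun x => a * f x) vs = fun x => a * iter_derive f vs x.
Proof.
move=> sf; elim: vs => //= v vs ->; apply/funext => x.
rewrite (_ : (fun y => _) = a *: iter_derive f vs)// deriveZ//.
exact: diff_derivable.
Qed.

Lemma smoothZ (a : R) f : smooth f -> smooth (fun x => a * f x).
Proof.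
move=> sf vs x; rewrite iter_deriveZ//.
exact: (@differentiableZ _ _ _ (iter_derive f vs) a x).
Qed.

End PolynomialFunctions.

(** * Square integrable functions on a surface *)

Section L2Calculus.
Variables (R : realType) (d : nat) (G : set 'rV[R]_d).
Local Notation V := 'rV[R]_d.
Local Notation S := (surface_space R d).
Local Notation mu := (surface_measure R d).
Hypothesis mG : measurable (G : set S).
Implicit Types (v w : V -> R).

Let measurable_on v := measurable_fun (G : set S) (v : S -> R).

Lemma eq_surface_integral v w : {in G, v =1 w} ->
  surface_integral G v = surface_integral G w.
Proof. by move=> vw; apply: eq_integral => x Gx; rewrite vw. Qed.

Lemma eq_L2norm v w : {in G, v =1 w} -> L2norm G v = L2norm G w.
Proof.
by move=> vw; congr (_ `^ _)%E; apply: eq_surface_integral => x Gx; rewrite vw.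
Qed.

Lemma eq_L2 v w : {in G, v =1 w} -> L2 G v -> L2 G w.
Proof.
move=> vw [mv lv]; split; last by rewrite -(eq_L2norm vw).
by apply: eq_measurable_fun mv => x Gx; apply: vw.
Qed.

Lemma eq_L2dot v v' w : {in G, v =1 v'} -> L2dot G v w = L2dot G v' w.
Proof. by move=> vv; congr fine; apply: eq_surface_integral => x Gx; rewrite vv. Qed.

Lemma L2dotC v w : L2dot G v w = L2dot G w v.
Proof. by congr fine; apply: eq_surface_integral => x _; rewrite mulrC. Qed.

Lemma L2norm_ltyP v :
  (L2norm G v < +oo)%E <-> (surface_integral G (fun x => (v x ^+ 2)%R) < +oo)%E.
Proof.
split; last exact: poweR_lty.
by apply: lty_poweRy; rewrite invr_eq0 pnatr_eq0.
Qed.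

Lemma L2norm_ge0 v : (0 <= L2norm G v)%E.
Proof. exact: poweR_ge0. Qed.

Lemma L2norm0 : L2norm G (fun=> 0) = 0%E.
Proof.
rewrite /L2norm /surface_integral.
under eq_integral do rewrite expr0n /=.
by rewrite integral0 poweR0r// invr_eq0 pnatr_eq0.
Qed.

Lemma L2_0 : L2 G (fun=> 0).
Proof. by split; [exact: measurable_cst|rewrite L2norm0]. Qed.

Let measurable_sqr v : measurable_on v -> measurable_on (fun x => v x ^+ 2).
Proof. by move=> mv; exact: measurable_funX. Qed.

Lemma le_surface_integral v w : measurable_on v -> measurable_on w ->
  {in G, forall x, 0 <= v x <= w x} ->
  (surface_integral G v <= surface_integral G w)%E.
Proof.
move=> mv mw vw; rewrite /surface_integral; apply: ge0_le_integral.
- exact: mG.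
- by move=> x Gx; rewrite lee_fin; have /andP[] := vw x (mem_set Gx).
- exact/measurable_EFinP.
- exact/measurable_EFinP.
- by move=> x Gx; rewrite lee_fin; have /andP[] := vw x (mem_set Gx).
Qed.

Lemma surface_integralZl (a : R) v : 0 <= a -> measurable_on v ->
  {in G, forall x, 0 <= v x} ->
  surface_integral G (fun x => a * v x) = (a%:E * surface_integral G v)%E.
Proof.
move=> a0 mv v0; rewrite /surface_integral.
under eq_integral do rewrite EFinM.
apply: ge0_integralZl.
- exact: mG.
- exact/measurable_EFinP.
- by move=> x Gx; rewrite lee_fin v0 ?inE.
- by rewrite lee_fin.
Qed.

Lemma surface_integralD v w : measurable_on v -> measurable_on w ->
  {in G, forall x, 0 <= v x} -> {in G, forall x, 0 <= w x} ->
  surface_integral G (fun x => v x + w x) =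
  (surface_integral G v + surface_integral G w)%E.
Proof.
move=> mv mw v0 w0; rewrite /surface_integral.
under eq_integral do rewrite EFinD.
apply: ge0_integralD.
- exact: mG.
- by move=> x Gx; rewrite lee_fin v0 ?inE.
- exact/measurable_EFinP.
- by move=> x Gx; rewrite lee_fin w0 ?inE.
- exact/measurable_EFinP.
Qed.

Lemma surface_integral_ge0 v : {in G, forall x, 0 <= v x} ->
  (0 <= surface_integral G v)%E.
Proof. by move=> v0; apply: integral_ge0 => x Gx; rewrite lee_fin v0 ?inE. Qed.

Lemma L2_le v w : measurable_on v -> L2 G w -> {in G, forall x, `|v x| <= `|w x|} ->
  L2 G v.
Proof.
move=> mv [mw /L2norm_ltyP wfin] vw; split=> //; apply/L2norm_ltyP.
apply: le_lt_trans wfin; apply: le_surface_integral.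
- exact: measurable_sqr.
- exact: measurable_sqr.
- move=> x Gx; rewrite sqr_ge0 /= -[leLHS]ger0_norm ?sqr_ge0//.
  rewrite -[leRHS]ger0_norm ?sqr_ge0//.
  by rewrite !normrX lerXn2r ?nnegrE//; exact: vw.
Qed.

Lemma L2_cst (c : R) : (mu G < +oo)%E -> L2 G (fun=> c).
Proof.
move=> Gfin; split; first exact: measurable_cst.
apply/L2norm_ltyP; rewrite /surface_integral integral_cst//.
by rewrite lte_mul_pinfty// lee_fin sqr_ge0.
Qed.

Lemma L2_bounded v (M : R) : (mu G < +oo)%E -> measurable_on v ->
  {in G, forall x, `|v x| <= M} -> L2 G v.
Proof.
move=> Gfin mv vM; apply: (L2_le mv (L2_cst M Gfin)) => x Gx.
exact: le_trans (vM x Gx) (ler_norm _).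
Qed.

Lemma L2normZ (a : R) v : measurable_on v ->
  L2norm G (fun x => a * v x) = (`|a|%:E * L2norm G v)%E.
Proof.
move=> mv; rewrite /L2norm.
rewrite (@eq_surface_integral _ (fun x => a ^+ 2 * v x ^+ 2)); last first.
  by move=> x _; rewrite exprMn.
rewrite surface_integralZl ?sqr_ge0//; last 2 first.
- exact: measurable_sqr.
- by move=> x _; exact: sqr_ge0.
rewrite poweRM ?lee_fin ?sqr_ge0//; last first.
  by apply: surface_integral_ge0 => x _; exact: sqr_ge0.
congr (_ * _)%E; rewrite poweR_EFin; congr EFin.
by rewrite powR12_sqrt ?sqr_ge0// sqrtr_sqr.
Qed.

Lemma L2Z (a : R) v : L2 G v -> L2 G (fun x => a * v x).
Proof.
move=> [mv vfin]; split.
  by apply: measurable_funM => //; exact: measurable_cst.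
by rewrite L2normZ// lte_mul_pinfty.
Qed.

Lemma L2D v w : L2 G v -> L2 G w -> L2 G (fun x => v x + w x).
Proof.
move=> [mv /L2norm_ltyP vfin] [mw /L2norm_ltyP wfin].
have mvw : measurable_on (fun x => v x + w x) by exact: measurable_funD.
split=> //; apply/L2norm_ltyP.
have m2 u : measurable_on u -> measurable_on (fun x => 2 * u x ^+ 2).
  by move=> mu_; apply: measurable_funM; [exact: measurable_cst|exact: measurable_sqr].
have pos2 (u : V -> R) : {in G, forall x, 0 <= 2 * u x ^+ 2}.
  by move=> x _; rewrite mulr_ge0 ?sqr_ge0.
have lt2 u : measurable_on u ->
    (surface_integral G (fun x => (u x ^+ 2)%R) < +oo)%E ->
    (surface_integral G (fun x => (2 * u x ^+ 2)%R) < +oo)%E.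
  move=> mu_ ufin; rewrite surface_integralZl//; last 2 first.
  - exact: measurable_sqr.
  - by move=> x _; exact: sqr_ge0.
  by rewrite lte_mul_pinfty.
apply: (@le_lt_trans _ _
    (surface_integral G (fun x => (2 * v x ^+ 2 + 2 * w x ^+ 2)%R))).
  apply: le_surface_integral.
  - exact: measurable_sqr.
  - by apply: measurable_funD; exact: m2.
  - move=> x _; rewrite sqr_ge0 /=.
    have := sqr_ge0 (v x - w x); rewrite !expr2; lra.
rewrite surface_integralD; [|exact: m2|exact: m2|exact: pos2|exact: pos2].
by rewrite lte_add_pinfty// lt2.
Qed.

Lemma L2_sum (I : Type) (s : seq I) (c : I -> R) (F : I -> V -> R) :
  (forall i, L2 G (F i)) -> L2 G (fun x => \sum_(i <- s) c i * F i x).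
Proof.
move=> lF; elim: s => [|i s ih].
  under eq_fun do rewrite big_nil.
  exact: L2_0.
under eq_fun do rewrite big_cons.
apply: L2D ih; exact: L2Z.
Qed.

Lemma L2B v w : L2 G v -> L2 G w -> L2 G (fun x => v x - w x).
Proof.
move=> lv lw; have := L2D lv (L2Z (-1) lw); apply: eq_L2 => x _.
by rewrite mulN1r.
Qed.

(** [|v w|] is at most [(|v| + |w|) ^ 2]. *)
Lemma L2_integrable_mul v w : L2 G v -> L2 G w ->
  mu.-integrable G (fun x => (v x * w x)%:E).
Proof.
move=> lv lw; have [mv _] := lv; have [mw _] := lw.
have mvw : measurable_on (fun x => v x * w x) by exact: measurable_funM.
apply/integrableP; split; first exact/measurable_EFinP.
have [msum /L2norm_ltyP sumfin] : L2 G (fun x => `|v x| + `|w x|).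
  apply: L2D.
    apply: (L2_le _ lv) => [|x _]; last by rewrite normr_id.
    exact: measurableT_comp.
  apply: (L2_le _ lw) => [|x _]; last by rewrite normr_id.
  exact: measurableT_comp.
apply: le_lt_trans sumfin.
apply: (@le_surface_integral (fun x => `|v x * w x|)).
- exact: measurableT_comp.
- exact: measurable_sqr.
- move=> x _; rewrite normr_ge0 normrM expr2 /=.
  have := normr_ge0 (v x); have := normr_ge0 (w x); nra.
Qed.

Lemma L2dotDl v1 v2 w : L2 G v1 -> L2 G v2 -> L2 G w ->
  L2dot G (fun x => v1 x + v2 x) w = L2dot G v1 w + L2dot G v2 w.
Proof.
move=> l1 l2 lw; rewrite /L2dot /surface_integral.
have i1 := L2_integrable_mul l1 lw; have i2 := L2_integrable_mul l2 lw.
under eq_integral do rewrite mulrDl EFinD.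
by rewrite integralD// fineD//; exact: integrable_fin_num.
Qed.

Lemma L2dotZl (a : R) v w : L2 G v -> L2 G w ->
  L2dot G (fun x => a * v x) w = a * L2dot G v w.
Proof.
move=> lv lw; rewrite /L2dot /surface_integral.
have i1 := L2_integrable_mul lv lw.
under eq_integral do rewrite -mulrA EFinM.
by rewrite integralZl// fineM//; exact: integrable_fin_num.
Qed.

Lemma L2dot_suml (I : Type) (s : seq I) (c : I -> R) (F : I -> V -> R) w :
  (forall i, L2 G (F i)) -> L2 G w ->
  L2dot G (fun x => \sum_(i <- s) c i * F i x) w = \sum_(i <- s) c i * L2dot G (F i) w.
Proof.
move=> lF lw; elim: s => [|i s ih].
  rewrite big_nil /L2dot /surface_integral.
  under eq_integral do rewrite big_nil mul0r.
  by rewrite integral0.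
under eq_fun do rewrite big_cons.
rewrite big_cons L2dotDl; [|exact: L2Z|exact: L2_sum|exact: lw].
by rewrite ih (L2dotZl (c i) (lF i) lw).
Qed.

Lemma L2dotBl v1 v2 w : L2 G v1 -> L2 G v2 -> L2 G w ->
  L2dot G (fun x => v1 x - v2 x) w = L2dot G v1 w - L2dot G v2 w.
Proof.
move=> l1 l2 lw; rewrite -[X in _ - X]mul1r -mulNr -(L2dotZl (-1) l2 lw).
rewrite -(L2dotDl l1 (L2Z (-1) l2) lw).
by apply: eq_L2dot => x _; rewrite mulN1r.
Qed.

Lemma L2dot_le v w (M : R) : (mu G < +oo)%E -> L2 G v -> L2 G w ->
  {in G, forall x, `|v x| <= M} ->
  `|L2dot G v w| <= M * L2dot G (fun=> 1) (fun x => `|w x|).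
Proof.
move=> Gfin lv lw vM.
have l1 := L2_cst 1 Gfin.
have law : L2 G (fun x => `|w x|).
  apply: (L2_le _ lw) => [|x _]; last by rewrite normr_id.
  by apply: measurableT_comp; [|exact: (proj1 lw)].
have i1 := L2_integrable_mul lv lw; have i2 := L2_integrable_mul l1 law.
rewrite -(L2dotZl M l1 law) /L2dot /surface_integral.
have i3 := L2_integrable_mul (L2Z M l1) law.
rewrite -fine_abse ?integrable_fin_num// fine_le ?integrable_fin_num//.
- by rewrite abse_fin_num integrable_fin_num.
apply: (le_trans (le_abse_integral _ mG (measurable_int _ i1))).
apply: (@le_surface_integral (fun x => `|v x * w x|) (fun x => M * 1 * `|w x|)).
- by move/measurable_int/measurable_EFinP: i1; exact: measurableT_comp.
- apply: measurable_funM; first exact: measurable_cst.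
  exact: (proj1 law).
- move=> x Gx; rewrite normr_ge0 normrM mulr1 ler_wpM2r//.
  exact: vM.
Qed.

End L2Calculus.

(** * Uniform approximation by polynomials *)

Section Bernstein.
Variables (R : realType) (d : nat).
Local Notation V := 'rV[R]_d.
Implicit Types (x y z : V) (g : V -> R) (s : seq 'I_d).

Section Walk.
Variables (u : 'I_d -> V -> R^o) (h : R).

(** The expectation of [g] at the end of the random walk that starts at [y]
    and, for each entry [i] of [s], makes a step of length [h] in the direction
    [i] with probability [u i x]. *)
Fixpoint walk s g x y : R :=
  if s is i :: s' then
    u i x * walk s' g x (y + h *: delta_mx 0 i) + (1 - u i x) * walk s' g x y
  else g y.

Lemma walk_polynomial s g y : (forall i, polynomial_function (u i)) ->
  polynomial_function (fun x => walk s g x y).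
Proof.
move=> pu; elim: s y => [|i s ih] y /=; first exact: polynomial_cst.
apply: polynomialD; apply: polynomialM => //.
have -> : (fun x => 1 - u i x) = (fun x => 1 + (-1) * u i x).
  by apply/funext => x; rewrite mulN1r.
by apply: polynomialD; [|apply: polynomialM => //]; exact: polynomial_cst.
Qed.

Lemma walk_le s g1 g2 x y : (forall i, 0 <= u i x <= 1) ->
  (forall z, g1 z <= g2 z) -> walk s g1 x y <= walk s g2 x y.
Proof.
move=> u01 g12; elim: s y => [|i s ih] y //=.
have /andP[u0 u1] := u01 i.
by rewrite lerD// ler_wpM2l// subr_ge0.
Qed.

Lemma walk_affine s g (a c : R) x y :
  walk s (fun z => a * g z + c) x y = a * walk s g x y + c.
Proof. by elim: s y => [|i s ih] y //=; rewrite !ih; ring. Qed.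

Lemma walk_sum s (I : Type) (r : seq I) (G : I -> V -> R) x y :
  walk s (fun z => \sum_(i <- r) G i z) x y = \sum_(i <- r) walk s (G i) x y.
Proof.
elim: s y => [|i s ih] y //=; rewrite !ih !mulr_sumr -big_split.
exact: eq_bigr.
Qed.

(** Mean and variance of a binomial distribution. *)
Lemma walk_sqr s j (c : R) x y :
  let n := (count_mem j s)%:R in
  walk s (fun z => (z 0 j - c) ^+ 2) x y =
  (y 0 j + n * h * u j x - c) ^+ 2 + n * h ^+ 2 * u j x * (1 - u j x).
Proof.
elim: s y => [|i s ih] y /=; first by rewrite !mul0r !addr0.
rewrite !ih !mxE /= natrD; case: (eqVneq i j) => [->|ij].
  by rewrite /= mulr1; ring.
by rewrite /= mulr0; ring.
Qed.

End Walk.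

(** Heine's theorem, in the form in which only one of the two points is confined
    to the compact set. *)
Lemma compact_modulus (K : set V) g (e : R) : compact K -> continuous g -> 0 < e ->
  exists2 del : R, 0 < del & forall x z, K x -> `|z - x| < del -> `|g z - g x| < e.
Proof.
move=> cK cg e0.
have H : \forall del \near 0^'+,
    K `<=` (fun x => forall z, `|z - x| < del -> `|g z - g x| < e).
  apply: ((compact_near_coveringP K).1 cK R (0^'+)).
  move=> x Kx; have e20 : 0 < e / 2 by rewrite divr_gt0.
  have /cvgrPdist_lt/(_ _ e20)/nbhs_ballP[r /= r0 rg] := cg x.
  exists (ball x (r / 2), [set t | 0 < t < r / 2]).
    split; first by apply: nbhsx_ballx; rewrite divr_gt0.
    near=> t; apply/andP; split; near: t; first exact: nbhs_right_gt.
    by apply: nbhs_right_lt; rewrite divr_gt0.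
  move=> [x' t] /= []; rewrite -ball_normE /= => xx' /andP[t0 tr] z zx'.
  have h1 : `|g x - g x'| < e / 2.
    apply: rg; rewrite -ball_normE /=; apply: (lt_trans xx'); lra.
  have h2 : `|g x - g z| < e / 2.
    apply: rg; rewrite -ball_normE /=; rewrite distrC.
    apply: le_lt_trans (ler_distD x' _ _) _; rewrite distrC in xx'; lra.
  apply: le_lt_trans (ler_distD (g x) _ _) _; rewrite distrC in h2; lra.
near (0 : R)^'+ => t; exists t; first by near: t; exact: nbhs_right_gt.
have Kt : K `<=` (fun x => forall z, `|z - x| < t -> `|g z - g x| < e) by near: t.
by move=> x z Kx; exact: Kt.
Unshelve. all: by end_near. Qed.

Lemma compact_coord_bound (K : set V) : compact K ->
  exists2 M : R, 0 < M & forall x i, K x -> `|x 0 i| <= M.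
Proof.
move=> cK; have [M [_ MK]] := compact_bounded cK.
exists (`|M| + 1); first by rewrite ltr_wpDl.
move=> x i Kx; apply: le_trans (le_coord_norm x i) _; apply: MK => //.
by rewrite (le_lt_trans (ler_norm _))// ltrDl.
Qed.

(** Stone and Weierstrass by multivariate Bernstein polynomials: a walk with [N]
    steps in each direction, the step probabilities being chosen such that it
    ends in [x] in the mean, ends near [x] with high probability. *)
Lemma polynomial_approximation (K : set V) (f : V -> R^o) (e : R) :
  compact K -> {within K, continuous f} -> 0 < e ->
  exists2 g, polynomial_function g & forall x, K x -> `|g x - f x| <= e.
Proof.
move=> cK cf e0.
have clK : closed K by apply: compact_closed => //; exact: norm_hausdorff.
have [B B0 fB] : exists2 B : R, 0 < B & forall x, K x -> `|f x| <= B.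
  have /compact_bounded[B [_ BK]] := continuous_compact cf cK.
  exists (`|B| + 1); first by rewrite ltr_wpDl.
  move=> x Kx; apply: BK; last by exists x.
  by rewrite (le_lt_trans (ler_norm _))// ltrDl.
have [g [fg cg gB]] := continuous_bounded_extension
  (@pseudometric_normal R V) clK B0 cf fB.
have e20 : 0 < e / 2 by rewrite divr_gt0.
have [del del0 gdel] := compact_modulus cK cg e20.
have [M M0 KM] := compact_coord_bound cK.
pose C := 2 * B / del ^+ 2.
have C0 : 0 <= C by rewrite divr_ge0 ?sqr_ge0// mulr_ge0// ltW.
(* Close to [x] use the modulus of continuity, and far from it the bound [2 * B]
   on the variation of [g]. *)
have modulus x z : K x ->
    `|g z - g x| <= C * (\sum_j (z 0 j - x 0 j) ^+ 2) + e / 2.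
  move=> Kx; have S0 : 0 <= \sum_j (z 0 j - x 0 j) ^+ 2.
    by apply: sumr_ge0 => j _; exact: sqr_ge0.
  have [zx|zx] := ltP `|z - x| del.
    apply: (le_trans (ltW (gdel x z Kx zx))).
    by rewrite lerDr mulr_ge0.
  apply: (@le_trans _ _ (2 * B)).
    apply: (le_trans (ler_normB _ _)); rewrite mulrDl !mul1r.
    by apply: lerD; exact: gB.
  apply: (@le_trans _ _ (C * \sum_j (z 0 j - x 0 j) ^+ 2)); last first.
    by rewrite lerDl ltW.
  rewrite /C mulrAC ler_pdivlMr ?exprn_gt0// ler_wpM2l ?mulr_ge0 ?(ltW B0)//.
  have -> : \sum_j (z 0 j - x 0 j) ^+ 2 = enorm (z - x) ^+ 2.
    rewrite -dotv_enorm; apply: eq_bigr => j _; by rewrite !mxE expr2.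
  rewrite lerXn2r ?nnegrE ?sqrtr_ge0 ?(ltW del0)//.
  exact: le_trans zx (le_norm_enorm _).
have [N N0 CN] : exists2 N, (0 < N)%N &
    C * (\sum_(j < d) 4 * M ^+ 2 / N%:R) <= e / 2.
  pose Q := C * (d%:R * (4 * M ^+ 2)).
  have Q0 : 0 <= Q.
    rewrite /Q; apply: mulr_ge0 => //; apply: mulr_ge0 => //; apply: mulr_ge0 => //.
    exact: sqr_ge0.
  have Q1 : 0 < Q + 1 by rewrite ltr_wpDl.
  have [m] := ltr_add_invr (divr_gt0 e20 Q1).
  rewrite add0r ltr_pdivlMr// => me; exists m.+1 => //; apply: le_trans (ltW me).
  rewrite mulrDr mulr1 sumr_const card_ord -[leLHS]addr0 lerD ?invr_ge0//.
  by rewrite -mulr_natl le_eqVlt; apply/orP; left; apply/eqP; rewrite /Q; ring.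
have NR0 : 0 < N%:R :> R by rewrite ltr0n.
(* The walk starts at the corner [(- M, ..., - M)] of a cube that contains [K]
   and ends at most at the opposite corner; [u] maps the cube to the unit cube. *)
pose u (i : 'I_d) (x : V) : R^o := x 0 i * (2 * M)^-1 + 2^-1.
pose h := 2 * M / N%:R.
pose s : seq 'I_d := flatten (nseq N (enum 'I_d)).
pose y0 : V := const_mx (- M).
have count_s j : count_mem j s = N.
  rewrite count_flatten map_nseq sumn_nseq count_uniq_mem ?enum_uniq//.
  by rewrite mem_enum mul1n.
have pu i : polynomial_function (u i).
  apply: polynomialD; last exact: polynomial_cst.
  by apply: polynomialM; [exact: polynomial_coord|exact: polynomial_cst].
exists (fun x => walk u h s g x y0); first exact: walk_polynomial.
move=> x Kx.
have u01 i : 0 <= u i x <= 1.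
  have := KM x i Kx; rewrite ler_norml => /andP[x1 x2].
  have uE : u i x = (x 0 i + M) / (2 * M).
    by rewrite /u; field; rewrite gt_eqF.
  by rewrite uE ler_pdivrMr ?ler_pdivlMr ?mulr_gt0//; apply/andP; split; lra.
have hu i : N%:R * h * u i x = x 0 i + M.
  by rewrite /h /u; field; rewrite !gt_eqF.
have var : walk u h s (fun z => \sum_j (z 0 j - x 0 j) ^+ 2) x y0 <=
    \sum_(j < d) 4 * M ^+ 2 / N%:R.
  rewrite walk_sum; apply: ler_sum => j _; rewrite walk_sqr count_s hu mxE.
  rewrite (_ : - M + _ - _ = 0); last by ring.
  rewrite expr0n /= add0r (_ : N%:R * h ^+ 2 = 4 * M ^+ 2 / N%:R); last first.
    by rewrite /h; field; rewrite gt_eqF.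
  have var0 : 0 <= 4 * M ^+ 2 / N%:R.
    apply: divr_ge0 => //; apply: mulr_ge0 => //; exact: sqr_ge0.
  rewrite -mulrA ler_piMr//.
  have /andP[u0 u1] := u01 j; nra.
have wsq a c : walk u h s (fun z => a * (\sum_j (z 0 j - x 0 j) ^+ 2) + c) x y0 =
    a * walk u h s (fun z => \sum_j (z 0 j - x 0 j) ^+ 2) x y0 + c.
  exact: walk_affine.
have fgx : f x = g x by apply: fg; rewrite inE.
rewrite fgx.
have := ler_wpM2l C0 var => Cvar.
rewrite ler_norml; apply/andP; split.
  have : walk u h s (fun z => (- C) * (\sum_j (z 0 j - x 0 j) ^+ 2) + (g x - e / 2)) x y0
      <= walk u h s g x y0.
    apply: walk_le => // z; have := modulus x z Kx; rewrite ler_norml => /andP[]; lra.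
  rewrite wsq; lra.
have : walk u h s g x y0 <=
    walk u h s (fun z => C * (\sum_j (z 0 j - x 0 j) ^+ 2) + (g x + e / 2)) x y0.
  apply: walk_le => // z; have := modulus x z Kx; rewrite ler_norml => /andP[]; lra.
rewrite wsq; lra.
Qed.

End Bernstein.

(** * The spaces H^1 and H^(1/2) *)

(** The integral of a nonnegative function is a supremum over the simple functions
    below it.  With this form the K-functional can be integrated without a proof
    that it is measurable in [t]. *)
Lemma ge0_le_integral_nonmeasurable d (T : measurableType d) (R : realType)
    (mu : {measure set T -> \bar R}) (D : set T) (f g : T -> \bar R) :
  (forall x, D x -> 0 <= f x)%E -> (forall x, D x -> f x <= g x)%E ->
  (\int[mu]_(x in D) f x <= \int[mu]_(x in D) g x)%E.
Proof.
move=> f0 fg; have g0 x : D x -> (0 <= g x)%E.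
  by move=> Dx; exact: le_trans (f0 x Dx) (fg x Dx).
rewrite !ge0_integralE//; apply: ge_ereal_sup => _ [h hf <-].
apply: ereal_sup_ubound; exists h => // x; apply: (le_trans (hf x)).
exact: lee_restrict.
Qed.

Lemma poweR2_mono (R : realType) (a b : \bar R) : (0 <= a)%E -> (a <= b)%E ->
  (a `^ 2 <= b `^ 2)%E.
Proof.
move=> a0 ab; apply: gt0_ler_poweR => //; rewrite in_itv /= ?a0 ?leey//.
by rewrite (le_trans a0 ab).
Qed.

Lemma poweR12_mono (R : realType) (a b : \bar R) : (0 <= a)%E -> (a <= b)%E ->
  (a `^ 2^-1 <= b `^ 2^-1)%E.
Proof.
move=> a0 ab; apply: gt0_ler_poweR => //; rewrite in_itv /= ?a0 ?leey//.
by rewrite (le_trans a0 ab).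
Qed.

Section SobolevSpaces.
Variables (R : realType) (d : nat) (Omega G : set 'rV[R]_d).
Local Notation V := 'rV[R]_d.
Local Notation S := (surface_space R d).
Local Notation mu := (surface_measure R d).
Hypothesis cG : compact G.
Hypothesis GO : G `<=` boundary Omega.
Hypothesis Gfin : (mu G < +oo)%E.
Implicit Types (v w : V -> R).

Let clG : closed G.
Proof. by apply: compact_closed => //; exact: norm_hausdorff. Qed.

Let mG : measurable (G : set S).
Proof. exact: closed_surface_measurable. Qed.

Lemma within_continuous_measurable (F : set V) (f : V -> R) :
  closed F -> {within F, continuous f} ->
  measurable_fun (F : set S) (f : S -> R).
Proof.
move=> clF cf mF; apply: (measurability _ (RGenCInfty.measurableE R)).
move=> _ [_ [a ->] <-]; apply: closed_surface_measurable.
have : closed (f @^-1` `[a, +oo[ : set (subspace F)).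
  by apply: preimage_closed; [move=> x _; exact: cf|exact: interval_closed].
  by rewrite -closed_setSI.
exact: mF.
Qed.

Lemma within_continuous_L2 (f : V -> R) : {within G, continuous f} -> L2 G f.
Proof.
move=> cf; have [M [_ MG]] := compact_bounded (continuous_compact cf cG).
apply: (@L2_bounded _ _ _ mG _ (`|M| + 1)).
- exact: Gfin.
- exact: within_continuous_measurable.
- move=> x /set_mem Gx; apply: MG; last by exists x.
  by rewrite (le_lt_trans (ler_norm _))// ltrDl.
Qed.

Lemma continuous_L2 (f : V -> R) : continuous f -> L2 G f.
Proof. by move=> cf; apply: within_continuous_L2; exact: continuous_subspaceT. Qed.

(** Tangential derivatives of first order combine partial derivatives, which are
    continuous, with coefficients that are products of components of the normal,
    which is bounded and measurable. *)
Lemma tangential_derive_L2 (f : V -> R^o) s : smooth f -> (size s <= 1)%N ->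
  L2 G (tangential_derive Omega f s).
Proof.
move=> sf; case: s => [|i [|//]] _.
  by apply: continuous_L2 => x; apply: differentiable_continuous; exact: (sf [::] x).
have lD k : L2 G ('D_(delta_mx 0 k) f).
  apply: continuous_L2 => x; apply: differentiable_continuous.
  exact: (sf [:: delta_mx 0 k] x).
have lN k w : L2 G w -> L2 G (fun x => normal Omega x 0 k * w x).
  move=> lw; apply: (L2_le mG _ lw).
    by apply: measurable_funM; [exact: measurable_normal|exact: (proj1 lw)].
  by move=> x _; rewrite normrM ler_piMl// normal_le1.
rewrite (_ : tangential_derive _ _ _ = fun x => 'D_(delta_mx 0 i) f x -
    normal Omega x 0 i * \sum_k 1 * (normal Omega x 0 k * 'D_(delta_mx 0 k) f x)).
  apply: (L2B mG (lD i)).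
  apply: (lN i); apply: (L2_sum mG) => k; apply: lN; exact: lD.
apply/funext => x; rewrite tangential_derive1; last exact: (sf [::] x).
by under [in RHS]eq_bigr do rewrite mul1r.
Qed.

Lemma smooth_H1 (f : V -> R^o) : smooth f -> H1 Omega G f.
Proof.
move=> sf; exists (tangential_derive Omega f); split.
- by [].
- move=> s; exact: tangential_derive_L2.
exists (fun=> f); split=> // s _.
rewrite (_ : (fun n => _) = fun=> 0%E); first exact: cvg_cst.
apply/funext => n; rewrite -(L2norm0 G); apply: eq_L2norm => x _.
by rewrite subrr.
Qed.

Lemma H1_L2 v : H1 Omega G v -> L2 G v.
Proof. by move=> [D [<- lD _]]; exact: lD. Qed.

Lemma H1norm_ge0 v : (0 <= H1norm Omega G v)%E.
Proof. by apply: le_ereal_inf_tmp => _ [D _ <-]; exact: poweR_ge0. Qed.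

Lemma H1norm_lty v : H1 Omega G v -> (H1norm Omega G v < +oo)%E.
Proof.
move=> [D sD]; have [DE lD _] := sD.
apply: (@le_lt_trans _ _ ((L2norm G v `^ 2 +
    \sum_(i < d) L2norm G (D [:: i]) `^ 2) `^ 2^-1)%E).
  by apply: ereal_inf_lbound; exists D.
apply: poweR_lty; rewrite lte_add_pinfty//.
  by apply: poweR_lty; rewrite -DE; exact: (proj2 (lD [::] isT)).
rewrite lte_sum_pinfty// => i _; apply: poweR_lty.
exact: (proj2 (lD [:: i] isT)).
Qed.

Lemma H1_0 : H1 Omega G (fun=> 0).
Proof. by apply: smooth_H1; apply: polynomial_smooth; exact: polynomial_cst. Qed.

Lemma sobolev_derivsZ (a : R) v D : sobolev_derivs Omega G 1 v D ->
  sobolev_derivs Omega G 1 (fun x => a * v x) (fun s x => a * D s x).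
Proof.
move=> [DE lD [f [sf fD]]]; split; first by rewrite DE.
  by move=> s s1; apply: (L2Z mG); exact: lD.
exists (fun n x => a * f n x); split; first by move=> n; exact: smoothZ.
move=> s s1.
rewrite (_ : (fun n => _) = fun n => (`|a|%:E *
  L2norm G (fun x => (tangential_derive Omega (f n) s x - D s x)%R))%E); last first.
  apply/funext => n; rewrite -(L2normZ mG); last first.
    by apply: measurable_funB;
      [exact: (proj1 (tangential_derive_L2 (sf n) s1))|exact: (proj1 (lD s s1))].
  apply: eq_L2norm => x _; rewrite mulrBr; congr (_ - _).
  by rewrite /tangential_derive iter_deriveZ.
by rewrite -(mule0 `|a|%:E); apply: cvgeZl => //; exact: fD.
Qed.

Lemma H1Z (a : R) v : H1 Omega G v -> H1 Omega G (fun x => a * v x).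
Proof. by move=> [D sD]; exists (fun s x => a * D s x); exact: sobolev_derivsZ. Qed.

Lemma H1normZ_le (a : R) v : 0 < a ->
  (H1norm Omega G (fun x => a * v x)%R <= a%:E * H1norm Omega G v)%E.
Proof.
move=> a0; rewrite -lee_pdivrMl//; apply: le_ereal_inf_tmp => _ [D sD <-].
rewrite lee_pdivrMl//; have [DE lD _] := sD.
apply: (@le_trans _ _ ((L2norm G (fun x => a * v x)%R `^ 2 +
    \sum_(i < d) L2norm G (fun x => a * D [:: i] x)%R `^ 2) `^ 2^-1)%E).
  apply: ereal_inf_lbound; exists (fun s x => a * D s x); [exact: sobolev_derivsZ|].
  reflexivity.
have aE w : L2 G w ->
    (L2norm G (fun x => a * w x)%R `^ 2 = (a ^+ 2)%:E * L2norm G w `^ 2)%E.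
  move=> lw; rewrite (L2normZ mG); last exact: (proj1 lw).
  rewrite poweRM ?lee_fin ?L2norm_ge0// gtr0_norm//; congr (_ * _)%E.
  by rewrite poweR_EFin powR_mulrn// ltW.
rewrite aE; last by rewrite -DE; exact: lD.
rewrite (eq_bigr (fun i => (a ^+ 2)%:E * L2norm G (D [:: i]) `^ 2)%E); last first.
  by move=> i _; apply: aE; exact: lD.
rewrite -ge0_sume_distrr; last by move=> i _; exact: poweR_ge0.
rewrite -muleDr//; last first.
  by rewrite ge0_adde_def// inE ?poweR_ge0 ?sume_ge0// => *; exact: poweR_ge0.
rewrite poweRM; last 2 first.
- by rewrite lee_fin sqr_ge0.
- by rewrite adde_ge0 ?poweR_ge0// sume_ge0// => *; exact: poweR_ge0.
by rewrite poweR_EFin powR12_sqrt ?sqr_ge0// sqrtr_sqr gtr0_norm.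
Qed.

(** Homogeneity gives [x <= x / 2] for the norm [x] of zero. *)
Lemma H1norm0 : H1norm Omega G (fun=> 0) = 0%E.
Proof.
apply/eqP; rewrite eq_le H1norm_ge0 andbT.
have fin : H1norm Omega G (fun=> 0) \is a fin_num.
  by rewrite ge0_fin_numE ?H1norm_ge0// H1norm_lty//; exact: H1_0.
have half0 : 0 < 2^-1 :> R by rewrite invr_gt0.
have := H1normZ_le (fun=> 0) half0; under eq_fun do rewrite mulr0.
rewrite -(fineK fin) -EFinM !lee_fin; lra.
Qed.

Lemma Kfunctional_ge0 (t : R) v : 0 < t -> (0 <= Kfunctional Omega G t v)%E.
Proof.
move=> t0; apply: le_ereal_inf_tmp => _ [w _ <-].
by rewrite adde_ge0 ?L2norm_ge0// mule_ge0 ?H1norm_ge0// lee_fin ltW.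
Qed.

Lemma le_Kfunctional (t : R) v w : H1 Omega G w ->
  (Kfunctional Omega G t v <=
   L2norm G (fun x => v x - w x)%R + t%:E * H1norm Omega G w)%E.
Proof. by move=> Hw; apply: ereal_inf_lbound; exists w. Qed.

Lemma Kfunctional_le_L2norm (t : R) v : (Kfunctional Omega G t v <= L2norm G v)%E.
Proof.
apply: (le_trans (le_Kfunctional t v H1_0)); rewrite H1norm0 mule0 adde0.
by rewrite le_eqVlt; apply/orP; left; apply/eqP/eq_L2norm => x _; rewrite subr0.
Qed.

Lemma Kfunctional_le_H1norm (t : R) v : H1 Omega G v ->
  (Kfunctional Omega G t v <= t%:E * H1norm Omega G v)%E.
Proof.
move=> Hv; apply: (le_trans (le_Kfunctional t v Hv)).
rewrite (@eq_L2norm _ _ _ _ (fun=> 0)) ?L2norm0 ?add0e// => x _.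
by rewrite subrr.
Qed.

Lemma eq_Kfunctional (t : R) v w : {in G, v =1 w} ->
  Kfunctional Omega G t v = Kfunctional Omega G t w.
Proof.
move=> vw; rewrite /Kfunctional; congr ereal_inf.
apply/eq_imagel => u Hu; congr (_ + _)%E; apply: eq_L2norm => x Gx /=.
by rewrite vw.
Qed.

Lemma le_Hhalf_norm v w :
  (forall t : R, 0 < t -> (Kfunctional Omega G t v <= Kfunctional Omega G t w)%E) ->
  (Hhalf_norm Omega G v <= Hhalf_norm Omega G w)%E.
Proof.
move=> K_le; apply: poweR12_mono.
  apply: integral_ge0 => t /= t0; rewrite mule_ge0 ?poweR_ge0//.
  by rewrite lee_fin invr_ge0 ltW.
apply: ge0_le_integral_nonmeasurable => t /= t0.
  by rewrite mule_ge0 ?poweR_ge0// lee_fin invr_ge0 ltW.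
rewrite lee_wpmul2r ?lee_fin ?invr_ge0 ?(ltW t0)//; apply: poweR2_mono.
  by rewrite mule_ge0 ?Kfunctional_ge0// lee_fin powR_ge0.
by rewrite lee_wpmul2l ?lee_fin ?powR_ge0// K_le.
Qed.

Lemma eq_Hhalf_norm v w : {in G, v =1 w} ->
  Hhalf_norm Omega G v = Hhalf_norm Omega G w.
Proof.
move=> vw; apply/eqP; rewrite eq_le.
by apply/andP; split; apply: le_Hhalf_norm => t t0; rewrite (eq_Kfunctional t vw).
Qed.

Lemma eq_Hhalf v w : {in G, v =1 w} -> Hhalf Omega G v -> Hhalf Omega G w.
Proof.
move=> vw [lv hv]; split; first exact: eq_L2 vw lv.
by rewrite -(eq_Hhalf_norm vw).
Qed.

Lemma Hhalf_norm0 : Hhalf_norm Omega G (fun=> 0) = 0%E.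
Proof.
have K0 (t : R) : 0 < t -> Kfunctional Omega G t (fun=> 0) = 0%E.
  move=> t0; apply/eqP; rewrite eq_le Kfunctional_ge0// andbT -(L2norm0 G).
  exact: Kfunctional_le_L2norm.
rewrite /Hhalf_norm integral0_eq ?poweR0r// ?invr_eq0 ?pnatr_eq0//.
by move=> t /= t0; rewrite K0// mule0 poweR0r ?mul0e// pnatr_eq0.
Qed.

(** With [A] and [B] the norms in [L_2] and [H^1], the K-functional is at most
    [min A (t * B)], so that the integrand of the norm is bounded by
    [2 * (A ^ 2 + B ^ 2) / (1 + t ^ 2)]. *)
Lemma H1_Hhalf v : H1 Omega G v -> Hhalf Omega G v.
Proof.
move=> Hv; have lv := H1_L2 Hv; split; first exact: lv.
apply: poweR_lty.
have [A AE] : exists A : R, L2norm G v = A%:E.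
  exists (fine (L2norm G v)); rewrite fineK// ge0_fin_numE ?L2norm_ge0//.
  exact: (proj2 lv).
have [B BE] : exists B : R, H1norm Omega G v = B%:E.
  exists (fine (H1norm Omega G v)); rewrite fineK// ge0_fin_numE ?H1norm_ge0//.
  exact: H1norm_lty.
have A0 : 0 <= A by rewrite -lee_fin -AE L2norm_ge0.
have B0 : 0 <= B by rewrite -lee_fin -BE H1norm_ge0.
pose M := (A ^+ 2 + B ^+ 2) * 2.
have M0 : 0 <= M by rewrite mulr_ge0// addr_ge0 ?sqr_ge0.
apply: (@le_lt_trans _ _ (\int[lebesgue_measure]_(t in [set t : R | (0 < t)%R])
   (M%:E * (oneDsqr t)^-1%R%:E))%E).
  apply: ge0_le_integral_nonmeasurable => t /= t0.
    by rewrite mule_ge0 ?poweR_ge0// lee_fin invr_ge0 ltW.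
  set k := Num.min A (t * B).
  have k0 : 0 <= k by rewrite le_min A0 mulr_ge0// ltW.
  apply: (@le_trans _ _ (((t `^ (- 2^-1))%:E * k%:E) `^ 2 * (t^-1)%:E)%E).
    rewrite lee_wpmul2r ?lee_fin ?invr_ge0 ?(ltW t0)//; apply: poweR2_mono.
      by rewrite mule_ge0 ?Kfunctional_ge0// lee_fin powR_ge0.
    rewrite lee_wpmul2l ?lee_fin ?powR_ge0//.
    rewrite EFin_min le_min -AE Kfunctional_le_L2norm /= EFinM -BE.
    exact: Kfunctional_le_H1norm.
  rewrite -!EFinM lee_fin powR_mulrn; last first.
    by rewrite mulr_ge0 ?powR_ge0.
  rewrite exprMn -powR_mulrn ?powR_ge0// -powRrM mulNr mulVf// powRN powRr1 ?(ltW t0)//.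
  rewrite -mulrA mulrCA -invfM.
  rewrite ler_pdivrMr ?mulr_gt0// mulrAC ler_pdivlMr ?(lt_le_trans ltr01)//.
  have kA : k ^+ 2 <= A ^+ 2 by rewrite lerXn2r ?nnegrE// ge_min lexx.
  have kB : k ^+ 2 <= t ^+ 2 * B ^+ 2.
    rewrite -exprMn lerXn2r ?nnegrE ?mulr_ge0 ?(ltW t0)//.
    by rewrite ge_min lexx orbT.
  rewrite /M /oneDsqr -expr2; have [t1|t1] := leP t 1.
    have : t ^+ 2 <= 1 by rewrite expr_le1// ltW.
    have := sqr_ge0 A; have := sqr_ge0 B; have := sqr_ge0 t; have := sqr_ge0 k.
    nra.
  have : 1 <= t ^+ 2 by rewrite exprn_ege1 ?ltW.
  have := sqr_ge0 A; have := sqr_ge0 B; have := sqr_ge0 k.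
  nra.
apply: (@le_lt_trans _ _ (\int[lebesgue_measure]_(t in `[0%R, +oo[)
   (M%:E * (oneDsqr t)^-1%R%:E))%E).
  rewrite (_ : [set t : R | 0 < t] = `]0%R, +oo[%classic); last first.
    by rewrite set_itvoy.
  apply: ge0_subset_integral.
  - exact: measurable_itv.
  - exact: measurable_itv.
  - apply/measurable_EFinP; apply: measurable_funTS.
    apply: continuous_measurable_fun => x; apply: cvgM; first exact: cvg_cst.
    exact: continuous_oneDsqrV.
  - by move=> t _; rewrite mule_ge0 ?lee_fin// invr_ge0 (le_trans ler01).
  - by apply: subset_itvr; rewrite bnd_simp.
rewrite ge0_integralZl//.
- by rewrite integral0y_oneDsqr -EFinM ltry.
- apply/measurable_EFinP; apply: measurable_funTS.
  by apply: continuous_measurable_fun; exact: continuous_oneDsqrV.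
Qed.

(** Interpolation: the image under [T] of a decomposition of [w] is at least as
    good a decomposition of [T w]. *)
Lemma Hhalf_norm_contraction (T : (V -> R) -> V -> R) w :
  (forall w1, H1 Omega G w1 ->
     [/\ H1 Omega G (T w1), (H1norm Omega G (T w1) <= H1norm Omega G w1)%E &
         (L2norm G (fun x => T w x - T w1 x)%R <=
          L2norm G (fun x => w x - w1 x)%R)%E]) ->
  (Hhalf_norm Omega G (T w) <= Hhalf_norm Omega G w)%E.
Proof.
move=> Tw; apply: le_Hhalf_norm => t t0; apply: le_ereal_inf_tmp => _ [w1 Hw1 <-].
have [HT TH TL] := Tw w1 Hw1.
apply: (le_trans (le_Kfunctional t _ HT)); apply: leeD => //.
by rewrite lee_wpmul2l// lee_fin ltW.
Qed.

End SobolevSpaces.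

(** * Piecewise polynomials on the facets *)

Section PiecewiseL2.
Variables (R : realType) (d : nat).
Local Notation V := 'rV[R]_d.
Local Notation S := (surface_space R d).
Local Notation mu := (surface_measure R d).
Implicit Types (v w : V -> R) (A B F : set V).

Lemma L2_set0 v : L2 set0 v.
Proof.
split; first exact: measurable_fun_set0.
by apply/L2norm_ltyP; rewrite /surface_integral integral_set0.
Qed.

Lemma L2_setU A B v : measurable (A : set S) -> measurable (B : set S) ->
  L2 A v -> L2 B v -> L2 (A `|` B) v.
Proof.
move=> mA mB [mvA /L2norm_ltyP vA] [mvB /L2norm_ltyP vB].
have mv : measurable_fun (A `|` B : set S) (v : S -> R).
  by apply/measurable_funU.
split; first exact: mv.
have sqr_m C : measurable_fun (C : set S) (v : S -> R) ->
    measurable_fun (C : set S) (fun x : S => (v x ^+ 2)%:E).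
  by move=> mvC; apply/measurable_EFinP; exact: measurable_funX.
have pos x : (0 <= (v x ^+ 2)%:E)%E by rewrite lee_fin sqr_ge0.
have mBA : measurable (B `\` A : set S) by exact: measurableD.
apply/L2norm_ltyP; rewrite /surface_integral.
rewrite (_ : (A `|` B) = A `|` (B `\` A)); last by rewrite setDE setUIr setUv setIT.
rewrite ge0_integral_setU.
- apply: lte_add_pinfty; first exact: vA.
  apply: le_lt_trans vB; apply: ge0_subset_integral.
  + exact: mBA.
  + exact: mB.
  + exact: sqr_m.
  + by move=> x _; exact: pos.
  + exact: subDsetl.
- exact: mA.
- exact: mBA.
- apply: sqr_m; apply: measurable_funS mv; first exact: measurableU.
  by apply: setUS; exact: subDsetl.
- by move=> x _; exact: pos.
- by apply/disj_setPS => x [Ax []].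
Qed.

(** The measure being complete, almost everywhere equality preserves
    measurability. *)
Lemma L2_ae F q v : measurable (F : set S) -> L2 F q ->
  {ae mu, forall x, F x -> v x = q x} -> L2 F v.
Proof.
move=> mF [mq /L2norm_ltyP qF] vq.
have aeE : ae_eq mu (F : set S) (EFin \o (q : S -> R)) (EFin \o (v : S -> R)).
  by apply: (@filterS _ _ (ae_filter_ringOfSetsType mu) _ _ _ vq) => x /= vqx /vqx ->.
have mv : measurable_fun (F : set S) (v : S -> R).
  apply/measurable_EFinP; apply: ae_measurable_fun aeE _.
    exact: measure_is_complete_caratheodory.
  exact/measurable_EFinP.
split; first exact: mv.
apply/L2norm_ltyP; rewrite /surface_integral.
rewrite (@ae_eq_integral _ _ _ mu F (fun x => (q x ^+ 2)%:E) (fun x => (v x ^+ 2)%:E)).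
- exact: qF.
- exact: mF.
- by apply/measurable_EFinP; exact: measurable_funX.
- by apply/measurable_EFinP; exact: measurable_funX.
- by apply: (@filterS _ _ (ae_filter_ringOfSetsType mu) _ _ _ vq) => x /= vqx /vqx ->.
Qed.

End PiecewiseL2.

Section FacetUnion.
Variables (R : realType) (d p : nat) (GammaD : set 'rV[R]_d).
Variable T : seq 'M[R]_(d.+1, d).
Hypothesis d_gt0 : (0 < d)%N.
Local Notation V := 'rV[R]_d.
Local Notation S := (surface_space R d).
Local Notation mu := (surface_measure R d).

Lemma facet_lty e : (mu (facet e) < +oo)%E.
Proof. exact: facet_hausdorff_lty. Qed.

Lemma measurable_facet (e : 'M[R]_(d.+1, d) * 'I_d.+1) :
  measurable (facet e : set S).
Proof.
apply: closed_surface_measurable; apply: compact_closed.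
  exact: norm_hausdorff.
exact: face_compact.
Qed.

Lemma polynomial_L2_facet e (q : V -> R^o) : polynomial_function q ->
  L2 (facet e) q.
Proof.
move=> pq; apply: continuous_L2.
- exact: face_compact.
- exact: facet_lty.
- exact: polynomial_continuous.
Qed.

Hypothesis GammaDE : GammaD = \bigcup_(e in [set` facets_in GammaD T]) facet e.

Lemma facet_union_compact : compact GammaD.
Proof.
rewrite GammaDE bigcup_seq; apply: bigsetU_compact => e _; exact: face_compact.
Qed.

Lemma facet_union_lty : (mu GammaD < +oo)%E.
Proof.
rewrite GammaDE bigcup_seq; elim: facets_in => [|e s ih].
  by rewrite big_nil measure0.
rewrite big_cons; apply: (le_lt_trans (outer_measureU2 (hausdorff_outer R d) _ _)).
by rewrite lte_add_pinfty//; exact: facet_lty.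
Qed.

Lemma Ydelta_L2 (v : V -> R) : Ydelta GammaD p T v -> L2 GammaD v.
Proof.
move=> Yv.
have vL2 e : e \in facets_in GammaD T -> L2 (facet e) v.
  move=> /Yv[q pq]; apply: L2_ae; first exact: measurable_facet.
  by apply: polynomial_L2_facet; exact: poly_degree_le_polynomial pq.
rewrite GammaDE bigcup_seq.
elim: (facets_in GammaD T) vL2 => [_|e s ih vL2].
  by rewrite big_nil; exact: L2_set0.
rewrite big_cons; apply: L2_setU.
- exact: measurable_facet.
- by apply: bigsetU_measurable => *; exact: measurable_facet.
- by apply: vL2; rewrite inE eqxx.
- by apply: ih => e' e's; apply: vL2; rewrite inE e's orbT.
Qed.

Lemma S0facets_L2 (v : V -> R) : S0facets GammaD p T v -> L2 GammaD v.
Proof.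
move=> [cv _]; apply: within_continuous_L2 => //.
- exact: facet_union_compact.
- exact: facet_union_lty.
Qed.

Lemma poly_degree_leD (q1 q2 : V -> R) : poly_degree_le p q1 ->
  poly_degree_le p q2 -> poly_degree_le p (fun x => q1 x + q2 x).
Proof.
move=> [c1 E1] [c2 E2]; exists (fun m => c1 m + c2 m) => x.
by rewrite E1 E2 -big_split; apply: eq_bigr => m _; rewrite mulrDl.
Qed.

Lemma poly_degree_leZ (a : R) (q : V -> R) : poly_degree_le p q ->
  poly_degree_le p (fun x => a * q x).
Proof.
move=> [c E]; exists (fun m => a * c m) => x.
by rewrite E mulr_sumr; apply: eq_bigr => m _; rewrite mulrA.
Qed.

Lemma poly_degree_le0 : poly_degree_le p (fun _ : V => 0 : R).
Proof. by exists (fun=> 0) => x; rewrite big1// => m _; rewrite mul0r. Qed.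

Lemma Ydelta_sum (I : Type) (s : seq I) (c : I -> R) (F : I -> V -> R) :
  (forall i, Ydelta GammaD p T (F i)) ->
  Ydelta GammaD p T (fun x => \sum_(i <- s) c i * F i x).
Proof.
move=> YF e eT; elim: s => [|i s [q pq qE]].
  exists (fun=> 0); first exact: poly_degree_le0.
  by apply: aeW => x _; rewrite big_nil.
have [qi pqi qiE] := YF i e eT.
exists (fun x => c i * qi x + q x).
  by apply: poly_degree_leD => //; exact: poly_degree_leZ.
apply: (@filterS2 _ _ (ae_filter_ringOfSetsType mu) _ _ _ _ qE qiE) => x /= h1 h2 ex.
by rewrite big_cons h1// h2.
Qed.

Lemma Xdelta_S0facets Omega (w : V -> R) : GammaD `<=` closure Omega ->
  Xdelta Omega p T w -> S0facets GammaD p T w.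
Proof.
move=> GO [cw pw]; split; first exact: continuous_subspaceW cw.
move=> e; rewrite mem_filter => /andP[_ /allpairsP[[K i] /= [KT _ ->]]].
have [q pq qE] := pw K KT; exists q => // x [l [l0 lS l1 xE]].
by apply: qE; exists l; split=> // j; rewrite inE.
Qed.

End FacetUnion.

(** * Matrices close to the identity *)

Section NearIdentity.
Variables (R : realType) (n : nat).

(** A left null vector [v] satisfies [v = v (1 - M)], and [1 - M] shrinks the
    maximum norm. *)
Lemma near_identity_unitmx (M : 'M[R]_n) (e : R) : 0 <= e -> n%:R * e < 1 ->
  (forall i j, `|(i == j)%:R - M i j| <= e) -> M \in unitmx.
Proof.
move=> e0 ne1 Me; rewrite -row_free_unit -kermx_eq0; apply/negPn/negP.
move=> /rowV0Pn[v /sub_kermxP vM v0].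
have vE : v = v *m (1%:M - M) by rewrite mulmxBr mulmx1 vM subr0.
have vle : `|v| <= `|v| * (n%:R * e).
  rewrite [leLHS]/Num.norm /= mx_normrE.
  apply: bigmax_le; first by rewrite !mulr_ge0.
  move=> [i j] _ /=; rewrite ord1 {1}vE mxE.
  apply: (le_trans (ler_norm_sum _ _ _)).
  rewrite mulrCA (_ : n%:R * _ = \sum_(k < n) `|v| * e); last first.
    by rewrite sumr_const card_ord mulr_natl.
  apply: ler_sum => k _; rewrite normrM !mxE ler_pM// ?le_coord_norm//.
move: vle; rewrite -subr_ge0 -[X in _ - X]mulr1 -mulrBr pmulr_rge0 ?normr_gt0//.
by rewrite subr_ge0 leNgt ne1.
Qed.

End NearIdentity.

(** * Bounded functionals on H^(1/2) *)

Section DualFunctionals.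
Variables (R : realType) (d : nat) (Omega G : set 'rV[R]_d).
Local Notation V := 'rV[R]_d.
Local Notation mu := (surface_measure R d).
Hypothesis cG : compact G.
Hypothesis GO : G `<=` boundary Omega.
Hypothesis Gfin : (mu G < +oo)%E.
Variable v : (V -> R) -> R.
Hypothesis Hv : Hmhalf Omega G v.

Let Hhalf0 : Hhalf Omega G (fun=> 0).
Proof. by apply: (H1_Hhalf cG GO Gfin); exact: H1_0. Qed.

Lemma Hmhalf0 : v (fun=> 0) = 0.
Proof.
have := Hv.1 1 _ _ Hhalf0 Hhalf0.
rewrite (_ : (fun x => _) = fun=> 0); first by lra.
by apply/funext => x; rewrite mulr0 addr0.
Qed.

Lemma HmhalfZ (a : R) w : Hhalf Omega G w -> v (fun x => a * w x) = a * v w.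
Proof.
move=> Hw; have := Hv.1 a _ _ Hw Hhalf0; rewrite Hmhalf0 addr0 => <-.
by congr v; apply/funext => x; rewrite addr0.
Qed.

Lemma dual_norm_ge0 : (0 <= dual_norm Omega G v)%E.
Proof.
apply: ereal_sup_ubound; exists (fun=> 0).
  by split; [exact: Hhalf0|rewrite Hhalf_norm0].
by rewrite Hmhalf0 normr0.
Qed.

(** The multiples of a function that vanishes on [G] have norm zero; a bounded
    functional is therefore bounded, hence zero, on the line that it spans. *)
Lemma Hmhalf_vanishing u : {in G, forall x, u x = 0} -> v u = 0.
Proof.
move=> u0; have uE (a : R) : {in G, (fun=> 0) =1 (fun x => a * u x)}.
  by move=> x Gx; rewrite u0// mulr0.
have Hau (a : R) : Hhalf Omega G (fun x => a * u x) by exact: eq_Hhalf (uE a) Hhalf0.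
have Hu : Hhalf Omega G u.
  by apply: eq_Hhalf Hhalf0 => x Gx; rewrite u0.
have [B BE] : exists B : R, dual_norm Omega G v = B%:E.
  exists (fine (dual_norm Omega G v)); rewrite fineK//.
  by rewrite ge0_fin_numE ?dual_norm_ge0//; exact: Hv.2.
have bound (a : R) : `|a| * `|v u| <= B.
  rewrite -normrM -(HmhalfZ a Hu) -lee_fin -BE; apply: ereal_sup_ubound.
  exists (fun x => a * u x); last by [].
  split; first exact: Hau.
  by rewrite -(eq_Hhalf_norm Omega (uE a)) Hhalf_norm0.
apply/eqP; apply: contraT => vu0; have nvu : 0 < `|v u| by rewrite normr_gt0.
have := bound ((`|B| + 1) / `|v u|).
rewrite ger0_norm ?divr_ge0 ?addr_ge0// divfK ?gt_eqF// => h.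
move: h (ler_norm B); lra.
Qed.

Lemma eq_Hmhalf w1 w2 : {in G, w1 =1 w2} -> Hhalf Omega G w2 -> v w1 = v w2.
Proof.
move=> w12 H2; pose u x := w1 x - w2 x.
have u0 : {in G, forall x, u x = 0} by move=> x Gx; rewrite /u w12// subrr.
have Hu : Hhalf Omega G u by apply: eq_Hhalf Hhalf0 => x Gx; rewrite u0.
have := Hv.1 1 _ _ Hu H2; rewrite (Hmhalf_vanishing u0) mulr0 add0r => <-.
by congr v; apply/funext => x; rewrite mul1r subrK.
Qed.

End DualFunctionals.

(** * The Scott-Zhang projector and its adjoint *)

Section ScottZhang.
Variables (R : realType) (d p : nat) (Omega GammaD : set 'rV[R]_d).
Variable T : seq 'M[R]_(d.+1, d).
Variable D : projector_data R d.
Hypothesis d_gt0 : (0 < d)%N.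
Hypothesis GO : GammaD `<=` boundary Omega.
Hypothesis GammaDE : GammaD = \bigcup_(e in [set` facets_in GammaD T]) facet e.
Hypothesis szD : scott_zhang_form GammaD p D T.
Variable C : R.
Hypothesis P2_L2 : P2_L2_bounded GammaD D C.
Hypothesis P2_H1 : P2_H1_bounded Omega GammaD D C.

Local Notation V := 'rV[R]_d.
Local Notation S := (surface_space R d).
Local Notation mu := (surface_measure R d).
Local Notation n := (pd_size D).
Local Notation phi := (pd_phi (p := D)).
Local Notation psi := (pd_psi (p := D)).
Local Notation P2 := (P2 GammaD D).
Local Notation H1 := (H1 Omega GammaD).
Local Notation Hhalf := (Hhalf Omega GammaD).
Implicit Types (w : V -> R).

Let cG : compact GammaD. Proof. exact: facet_union_compact GammaDE. Qed.
Let Gfin : (mu GammaD < +oo)%E. Proof. exact: facet_union_lty d_gt0 GammaDE. Qed.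
Let mG : measurable (GammaD : set S).
Proof.
apply: closed_surface_measurable; apply: compact_closed cG.
exact: norm_hausdorff.
Qed.

Let phi_S0 i : S0facets GammaD p T (phi i).
Proof. by have [[z [_ _ ]]] := szD. Qed.

Let L2phi i : L2 GammaD (phi i).
Proof. exact: (S0facets_L2 d_gt0 GammaDE (phi_S0 i)). Qed.

Let L2psi i : L2 GammaD (psi i).
Proof. by have [_ Ypsi _] := szD; exact: (Ydelta_L2 d_gt0 GammaDE (Ypsi i)). Qed.

Lemma L2_P2 w : L2 GammaD (P2 w).
Proof. exact: L2_sum. Qed.

Lemma P2B w1 w2 : L2 GammaD w1 -> L2 GammaD w2 ->
  P2 (fun x => w1 x - w2 x) = fun x => P2 w1 x - P2 w2 x.
Proof.
move=> l1 l2; apply/funext => x; rewrite /Defs.P2 -sumrB.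
by apply: eq_bigr => i _; rewrite (L2dotBl mG l1 l2 (L2psi i)) mulrBl.
Qed.

(** [P2] depends on [f] only through the products with the [psi j].  For
    polynomials close to the [phi i], the matrix of these products is close to the
    identity, hence invertible, and some combination of the polynomials has the
    products [b j]. *)
Lemma P2_polynomial_surjective (b : 'I_n -> R) :
  exists2 f : V -> R^o, polynomial_function f &
    P2 f = fun x => \sum_i b i * phi i x.
Proof.
have [_ _ dual] := szD.
pose c j := L2dot GammaD (fun=> 1) (fun x => `|psi j x|).
have c0 j : 0 <= c j.
  rewrite /c /L2dot fine_ge0//; apply: surface_integral_ge0 => x _.
  by rewrite mul1r.
pose C0 := \sum_j c j + 1.
have C00 : 0 < C0 by rewrite /C0 ltr_wpDl// sumr_ge0.
have cC0 j : c j <= C0.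
  by rewrite /C0 (bigD1 j)//= -addrA lerDl addr_ge0// sumr_ge0.
pose e : R := n.+1%:R^-1.
have eta0 : 0 < e / C0 by rewrite divr_gt0// invr_gt0.
have [g pg] : {g : 'I_n -> V -> R^o & forall i,
    polynomial_function (g i) /\ forall x, GammaD x -> `|g i x - phi i x| <= e / C0}.
  apply: (@choice _ _ (fun i gi => polynomial_function gi /\
    forall x, GammaD x -> `|gi x - phi i x| <= e / C0)) => i.
  have [gi pgi giE] := polynomial_approximation cG (proj1 (phi_S0 i)) eta0.
  by exists gi.
have L2g i : L2 GammaD (g i).
  by apply: continuous_L2 => //; apply: polynomial_continuous; exact: (pg i).1.
pose M := \matrix_(i < n, j < n) L2dot GammaD (g i) (psi j).
have uM : M \in unitmx.
  apply: (@near_identity_unitmx _ _ _ e).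
  - by rewrite invr_ge0.
  - by rewrite ltr_pdivrMr// mul1r ltr_nat.
  move=> i j; rewrite mxE eq_sym -dual distrC -(L2dotBl mG (L2g i) (L2phi i) (L2psi j)).
  apply: le_trans (@L2dot_le _ _ _ mG _ _ (e / C0) Gfin _ (L2psi j) _) _.
  - exact: L2B.
  - by move=> x /set_mem Gx; exact: (pg i).2.
  rewrite -mulrA ler_piMr ?invr_ge0// mulrC ler_pdivrMr// mul1r.
  exact: cC0.
pose a := \row_i b i *m invmx M.
exists (fun x => \sum_i a 0 i * g i x).
  apply: polynomial_sum => i _; apply: polynomialM; first exact: polynomial_cst.
  exact: (pg i).1.
apply/funext => x; apply: eq_bigr => j _; congr (_ * _).
rewrite (L2dot_suml mG _ _ L2g (L2psi j)).
have : (a *m M) 0 j = b j by rewrite mulmxKV// mxE.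
by rewrite mxE => <-; apply: eq_bigr => i _; rewrite [M i j]mxE.
Qed.

(** The combination is the image under [P2] of a polynomial, and [P2] preserves
    [H^1]. *)
Lemma H1_nodal (b : 'I_n -> R) : H1 (fun x => \sum_i b i * phi i x).
Proof.
have [f pf <-] := P2_polynomial_surjective b.
by apply: (P2_H1 _).1; apply: smooth_H1 => //; exact: polynomial_smooth.
Qed.

Lemma H1_P2 w : H1 (P2 w).
Proof. exact: H1_nodal. Qed.

(** Sums over sequences of indices, in which an index may be repeated, are the
    form in which linearity of functionals is propagated to sums. *)
Lemma H1_nodal_seq (s : seq 'I_n) (b : 'I_n -> R) :
  H1 (fun x => \sum_(i <- s) b i * phi i x).
Proof.
rewrite (_ : (fun x => _) =
    fun x => \sum_i (\sum_(j <- s | j == i) b j) * phi i x); first exact: H1_nodal.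
apply/funext => x; rewrite (partition_big id xpredT)//=.
apply: eq_bigr => i _; rewrite mulr_suml.
by apply: eq_bigr => j /eqP ->.
Qed.

Lemma Hhalf_phi i : Hhalf (phi i).
Proof.
apply: (H1_Hhalf cG GO Gfin); have := H1_nodal_seq [:: i] (fun=> 1).
rewrite (_ : (fun x => _) = phi i)//.
by apply/funext => x; rewrite big_seq1 mul1r.
Qed.

Lemma Hmhalf_nodal v (b : 'I_n -> R) : Hmhalf Omega GammaD v ->
  v (fun x => \sum_i b i * phi i x) = \sum_i b i * v (phi i).
Proof.
move=> Hv; elim: (index_enum _) => [|i s ih].
  rewrite big_nil -[RHS](Hmhalf0 cG GO Gfin Hv); congr v.
  by apply/funext => x; rewrite big_nil.
rewrite big_cons -ih -Hv.1; last 2 first.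
- exact: Hhalf_phi.
- by apply: (H1_Hhalf cG GO Gfin); exact: H1_nodal_seq.
by congr v; apply/funext => x; rewrite big_cons.
Qed.

Lemma Pi2_density v w : Hmhalf Omega GammaD v -> Hhalf w ->
  Pi2 GammaD D v w = L2dot GammaD w (Pi2fun D v).
Proof.
move=> Hv [lw _]; rewrite /Pi2 /Defs.P2 Hmhalf_nodal// L2dotC.
rewrite (L2dot_suml mG _ _ L2psi lw); apply: eq_bigr => i _.
by rewrite mulrC L2dotC.
Qed.

(** Divided by [max C 1], which is positive whatever the sign of [C], the
    projector is a contraction of [L_2] and of [H^1], hence of [H^(1/2)]. *)
Lemma Pi2_dual_norm_le v : Hmhalf Omega GammaD v ->
  (dual_norm Omega GammaD (Pi2 GammaD D v)
   <= (Num.max C 1)%:E * dual_norm Omega GammaD v)%E.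
Proof.
move=> Hv; set K := Num.max C 1.
have K0 : 0 < K by rewrite lt_max ltr01 orbT.
have CK (x : \bar R) : (0 <= x)%E -> (K^-1%:E * (C%:E * x) <= x)%E.
  move=> x0; rewrite muleA -EFinM -[leRHS]mul1e; apply: lee_wpmul2r => //.
  by rewrite lee_fin mulrC ler_pdivrMr// mul1r le_max lexx.
apply: ge_ereal_sup => _ [w [Hw w1] <-].
pose U w x := K^-1 * P2 w x.
have HU : Hhalf (U w).
  by apply: (H1_Hhalf cG GO Gfin); apply: (H1Z cG GO Gfin); exact: H1_P2.
have -> : Pi2 GammaD D v w = K * v (U w).
  rewrite /Pi2 -(HmhalfZ cG GO Gfin Hv _ HU); congr v; apply/funext => x.
  by rewrite /U mulrA divff ?mul1r// gt_eqF.
rewrite normrM gtr0_norm// EFinM lee_wpmul2l ?lee_fin ?(ltW K0)//.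
apply: ereal_sup_ubound; exists (U w); last by [].
split; first exact: HU.
apply: le_trans w1; apply: Hhalf_norm_contraction => w2 Hw2.
have [l1 _] := Hw; have l2 := H1_L2 Hw2.
have Ki0 : 0 < K^-1 by rewrite invr_gt0.
have [HP2 nP2] := P2_H1 Hw2.
split.
- by apply: (H1Z cG GO Gfin).
- apply: (le_trans (H1normZ_le cG GO Gfin (P2 w2) Ki0)).
  apply: le_trans (CK _ (H1norm_ge0 _ _ _)).
  by apply: lee_wpmul2l nP2; rewrite lee_fin ltW.
- rewrite (_ : (fun x => _) = fun x => K^-1 * P2 (fun x => w x - w2 x) x); last first.
    by rewrite P2B//; apply/funext => x; rewrite mulrBr.
  rewrite (L2normZ mG); last exact: (proj1 (L2_P2 _)).
  rewrite gtr0_norm//; apply: le_trans (CK _ (L2norm_ge0 _ _)).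
  apply: lee_wpmul2l; first by rewrite lee_fin ltW.
  by apply: P2_L2; exact: L2B.
Qed.

(** The coefficients of [w] in the nodal basis are its values at the nodes, and
    biorthogonality recovers them. *)
Lemma P2_S0facets w : S0facets GammaD p T w -> {in GammaD, w =1 P2 w}.
Proof.
have [[z [_ _ _ _ zE]] _ dual] := szD.
move=> Sw; have wE : {in GammaD, w =1 (fun x => \sum_i w (z i) * phi i x)}.
  by move=> x /set_mem Gx; exact: zE.
move=> x Gx; rewrite wE//; apply: eq_bigr => j _; congr (_ * _).
rewrite (eq_L2dot (psi j) wE) (L2dot_suml mG _ _ L2phi (L2psi j)).
rewrite (bigD1 j)//= dual eqxx mulr1 big1 ?addr0// => i ij.
by rewrite dual eq_sym (negbTE ij) mulr0.
Qed.

End ScottZhang.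

Theorem proposition4p3 (R : realType) (d p : nat)
    (Omega GammaD GammaN : set 'rV[R]_d)
    (D : seq 'M[R]_(d.+1, d) -> projector_data R d) :
  (2 <= d)%N -> (1 <= p)%N ->
  lipschitz_polytope Omega ->
  closed GammaD -> closed GammaN ->
  GammaD `|` GammaN = boundary Omega ->
  surface_measure R d (GammaD `&` GammaN) = 0%E ->
  (forall T, admissible Omega GammaD T -> scott_zhang_form GammaD p (D T) T) ->
  (forall kappa : R, exists C : R, forall T,
     admissible Omega GammaD T -> shape_regular kappa T ->
     [/\ P2_L2_bounded GammaD (D T) C, P2_H1_bounded Omega GammaD (D T) C &
         P2_approximates Omega GammaD p (D T) T C]) ->
  forall kappa : R, exists C : R, forall T,
    admissible Omega GammaD T -> shape_regular kappa T ->
    (forall (a : R) (v1 v2 : ('rV[R]_d -> R) -> R) (w : 'rV[R]_d -> R),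
       Pi2 GammaD (D T) (fun u => a * v1 u + v2 u) w =
       a * Pi2 GammaD (D T) v1 w + Pi2 GammaD (D T) v2 w) /\
    forall v, Hmhalf Omega GammaD v ->
      [/\ Ydelta GammaD p T (Pi2fun (D T) v),
          forall w, Hhalf Omega GammaD w ->
            Pi2 GammaD (D T) v w = L2dot GammaD w (Pi2fun (D T) v),
          (dual_norm Omega GammaD (Pi2 GammaD (D T) v)
             <= C%:E * dual_norm Omega GammaD v)%E &
          forall w, Xdelta Omega p T w -> v w - Pi2 GammaD (D T) v w = 0].
Proof.
move=> d2 _ _ _ _ GDN _ sz bounds kappa.
have [C boundsC] := bounds kappa.
exists (Num.max C 1) => T admT shT; split=> [//|v Hv].
have [PL PH _] := boundsC T admT shT; have [_ GE] := admT.
have szT := sz T admT.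
have d0 : (0 < d)%N by exact: ltnW d2.
have GO : GammaD `<=` boundary Omega by rewrite -GDN; exact: subsetUl.
have GC : GammaD `<=` closure Omega by move=> x /GO[].
have cG := facet_union_compact GE; have Gfin := facet_union_lty d0 GE.
split.
- by apply: Ydelta_sum => i; have [_ Ypsi _] := szT; exact: Ypsi.
- by move=> w Hw; exact: (Pi2_density d0 GO GE szT PH Hv Hw).
- exact: (Pi2_dual_norm_le d0 GO GE szT PL PH Hv).
- move=> w Xw; rewrite /Pi2; apply/eqP; rewrite subr_eq0; apply/eqP.
  apply: (eq_Hmhalf cG GO Gfin Hv).
    exact: (P2_S0facets d0 GE szT (Xdelta_S0facets GC Xw)).
  apply: (H1_Hhalf cG GO Gfin).
  exact: (H1_P2 d0 GO GE szT PH).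
Qed.
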